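(* Let $E,A\in C(\mathbb I,\mathbb R^{n,n})$ be sufficiently smooth and let the associated linear DAE $E(t)\dot x=A(t)x+f(t)$ (with $f\in C(\mathbb I,\mathbb R^n)$ sufficiently smooth) satisfy the Hypothesis (H) stated in the context, with characteristic values $\mu,a,d$. If $(E,A)$ is skew-adjoint, i.e. $E^T=E$ and $A^T=-A-\dot E$ as equality of functions on $\mathbb I$, then there are integers $p,q\ge 0$ with $d=p+q$ such that a sufficiently smooth, pointwise nonsingular $Q\in C^1(\mathbb I,\mathbb R^{n,n})$ in the transformation $x=Q(t)\begin{bmatrix}x_1\\ x_2\end{bmatrix}$ can be chosen from the restricted class of transformations described in the context in such a way that the inherent ODE $\dot x_1=\tilde A(t)x_1+\tilde f_1(t)$ fixed by $Q$ possesses a generalized orthogonal flow, i.e., for $t_0\in\mathbb I$ the solution $\Phi$ of $\dot\Phi=\tilde A(t)\Phi$, $\Phi(t_0)=I_{d}$, satisfies $\Phi(t)^TS\Phi(t)=S$ for all $t\in\mathbb I$, where $S=\begin{bmatrix}I_p&0\\0&-I_q\end{bmatrix}$.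
   Context: $\mathbb I\subseteq\mathbb R$ is a compact non-trivial interval. Derivative array: for $\mu\ge 0$ let $M_\mu(t)$ be the $(\mu+1)\times(\mu+1)$ block lower triangular matrix function with $n\times n$ blocks $$(M_\mu)_{i,j}=\tbinom{i}{j}E^{(i-j)}-\tbinom{i}{j+1}A^{(i-j-1)},\quad 0\le j\le i\le\mu,$$ (the second term being absent for $i=j$), and let $\mathcal A_\mu$ and $g_\mu$ denote the stacked functions $\mathcal A_\mu=[\,A^T\ \dot A^T\ \cdots\ (A^{(\mu)})^T\,]^T$ and $g_\mu=[\,f^T\ \dot f^T\ \cdots\ (f^{(\mu)})^T\,]^T$. Hypothesis (H) (for linear DAEs): there exist integers $\mu,a,d$ with $d=n-a$ such that for all $t\in\mathbb I$: 1. $\operatorname{rank}M_\mu(t)=(\mu+1)n-a$, such that there exists a smooth $Z_2$ of size $(\mu+1)n\times a$ and pointwise maximal rank with $Z_2^TM_\mu=0$; 2. $\operatorname{rank}\hat A_2(t)=a$, where $\hat A_2=Z_2^T\mathcal A_\mu$, such that there exists a smooth function of size $n\times d$ and pointwise maximal rank whose columns span $\ker\hat A_2$; call it $K$; 3. $\operatorname{rank}E(t)K(t)=d$, such that there exists a smooth $Z_1$ of size $n\times d$ and pointwise maximal rank with $\operatorname{rank}(Z_1^TEK)=d$. Reduced DAE: with $\hat E_1=Z_1^TE$, $\hat A_1=Z_1^TA$, $\hat f_1=Z_1^Tf$, $\hat f_2=Z_2^Tg_\mu$, it reads $\hat E_1\dot x=\hat A_1x+\hat f_1$, $0=\hat A_2x+\hat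 f_2$. Inherent ODE fixed by $Q$: write $Q=[\,T_2\ \ T_2'\,]$ with $T_2$ of size $n\times d$ and $T_2'$ of size $n\times a$, and require that $\hat A_2T_2'$ is pointwise nonsingular. Substituting $x=T_2x_1+T_2'x_2$ in the reduced DAE gives $$\hat E_1T_2\dot x_1+\hat E_1T_2'\dot x_2=(\hat A_1T_2-\hat E_1\dot T_2)x_1+(\hat A_1T_2'-\hat E_1\dot T_2')x_2+\hat f_1,\qquad 0=\hat A_2T_2x_1+\hat A_2T_2'x_2+\hat f_2.$$ Solving the second equation for $x_2$, differentiating it, eliminating $x_2$ and $\dot x_2$ from the first equation, and solving for $\dot x_1$ yields an ODE $\dot x_1=\tilde A(t)x_1+\tilde f_1(t)$ for $x_1\in\mathbb R^d$, the inherent ODE. Once $Q$ is fixed, it is uniquely determined (independent of the choices of $Z_1,Z_2$). Restricted class of transformations (skew-adjoint case): $Q=[\,T_2\ \ T_2'\,]$ with $T_2$ of size $n\times d$ and $T_2'$ of size $n\times a$ such that $\hat A_2T_2'$ is pointwise nonsingular, where $T_2=VW$ with smooth $V$ of size $n\times d$ having pointwise orthonormal columns that span $\ker\hat A_2$, and with smooth pointwise nonsingular $W$ of size $d\times d$ such that $W^TV^TEVW=S$, and where $T_2'$ is any smooth completion making $Q$ pointwise nonsingular. That is, only pointwise orthogonal transformations are used, with the exception of $W$. *)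

(* Defs.v *)
From HB Require Import structures.
From mathcomp Require Import all_boot all_order all_algebra.
From mathcomp Require Import all_classical all_reals all_analysis.

Set Implicit Arguments.
Unset Strict Implicit.
Unset Printing Implicit Defensive.

Import Order.TTheory GRing.Theory Num.Theory.
Import numFieldNormedType.Exports.
Local Open Scope classical_set_scope.
Local Open Scope ring_scope.

(* Functions on a compact interval I are represented by functions on R whose
   values outside I never matter: every derivative below is a limit of
   difference quotients along points of I (so it is one-sided at an endpoint
   of I), and it is only used at points of I. *)
Section CalculusOnI.
Variables (R : realType) (I : set R).

Definition diff_quot (g : R -> R) (t : R) : R -> R :=
  fun s => (g s - g t) / (s - t).

Definition diffI (g : R -> R) (t : R) : Prop :=
  cvg (diff_quot g t @ within I t^').

Definition derivI (g : R -> R) (t : R) : R :=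
  lim (diff_quot g t @ within I t^').

Fixpoint CkI (k : nat) (g : R -> R) : Prop :=
  if k is k'.+1 then (forall t, I t -> diffI g t) /\ CkI k' (derivI g)
  else {within I, continuous g}.

Definition CkMx (k m n : nat) (X : R -> 'M[R]_(m, n)) : Prop :=
  forall i j, CkI k (fun t => X t i j).

Definition diffMx (m n : nat) (X : R -> 'M[R]_(m, n)) (t : R) : Prop :=
  forall i j, diffI (fun s => X s i j) t.

Definition derivMx (m n : nat) (X : R -> 'M[R]_(m, n)) : R -> 'M[R]_(m, n) :=
  fun t => \matrix_(i, j) derivI (fun s => X s i j) t.

Definition derivnMx (k m n : nat) (X : R -> 'M[R]_(m, n)) :
    R -> 'M[R]_(m, n) :=
  iter k (@derivMx m n) X.

End CalculusOnI.

Section LinearDAE.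
Variables (R : realType) (I : set R) (n : nat).
Variables (E A : R -> 'M[R]_n) (f : R -> 'cV[R]_n) (mu a d : nat).

(* The row dimension (mu + 1) n appears as \sum_(i < mu.+1) n. *)
Local Notation N := (\sum_(i < mu.+1) n)%N.

(* No case distinction is needed: for i = j the second binomial coefficient
   vanishes, and for i < j both do. *)
Definition Mmu (t : R) : 'M[R]_N :=
  \mxblock_(i < mu.+1, j < mu.+1)
    (('C(i, j))%:R *: derivnMx I (i - j)%N E t
     - ('C(i, j.+1))%:R *: derivnMx I (i - j - 1)%N A t).

Definition Amu (t : R) : 'M[R]_(N, n) :=
  \mxcol_(i < mu.+1) derivnMx I i A t.

Definition gmu (t : R) : 'cV[R]_N :=
  \mxcol_(i < mu.+1) derivnMx I i f t.

Section Reduced.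
Variables (Z2 : R -> 'M[R]_(N, a)) (Z1 : R -> 'M[R]_(n, d)).

Definition A2hat (t : R) : 'M[R]_(a, n) := (Z2 t)^T *m Amu t.
Definition f2hat (t : R) : 'cV[R]_a := (Z2 t)^T *m gmu t.
Definition E1hat (t : R) : 'M[R]_(d, n) := (Z1 t)^T *m E t.
Definition A1hat (t : R) : 'M[R]_(d, n) := (Z1 t)^T *m A t.
Definition f1hat (t : R) : 'cV[R]_d := (Z1 t)^T *m f t.

(* Substituting x = T2 x1 + T2' x2 and solving the second equation gives
   x2 = x2G x1 + x2h, hence x2' = x2G' x1 + x2G x1' + x2h'; inserting both
   into the first equation gives
     odeL x1' = odeA x1 + odef. *)
Variables (T2 : R -> 'M[R]_(n, d)) (T2' : R -> 'M[R]_(n, a)).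

Definition x2G (t : R) : 'M[R]_(a, d) :=
  - (invmx (A2hat t *m T2' t) *m (A2hat t *m T2 t)).
Definition x2h (t : R) : 'cV[R]_a :=
  - (invmx (A2hat t *m T2' t) *m f2hat t).

Definition odeL (t : R) : 'M[R]_d :=
  E1hat t *m T2 t + E1hat t *m T2' t *m x2G t.
Definition odeA (t : R) : 'M[R]_d :=
  (A1hat t *m T2 t - E1hat t *m derivMx I T2 t)
  + (A1hat t *m T2' t - E1hat t *m derivMx I T2' t) *m x2G t
  - E1hat t *m T2' t *m derivMx I x2G t.
Definition odef (t : R) : 'cV[R]_d :=
  f1hat t
  + (A1hat t *m T2' t - E1hat t *m derivMx I T2' t) *m x2h t
  - E1hat t *m T2' t *m derivMx I x2h t.

(* x1' = Atil x1 + ftil is the inherent ODE; the elimination is required to be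
   possible, i.e. both matrices to be inverted are nonsingular on I. *)
Definition inherent_ODE (Atil : R -> 'M[R]_d) (ftil : R -> 'cV[R]_d) : Prop :=
  forall t, I t ->
    [/\ A2hat t *m T2' t \in unitmx, odeL t \in unitmx,
        Atil t = invmx (odeL t) *m odeA t
      & ftil t = invmx (odeL t) *m odef t].

End Reduced.

(* The smooth functions whose existence is part of the Hypothesis; "smooth"
   means of class C^r. *)
Definition admissible_Z2 (r : nat) (Z2 : R -> 'M[R]_(N, a)) : Prop :=
  CkMx I r Z2 /\
  forall t, I t -> \rank (Z2 t) = a /\ (Z2 t)^T *m Mmu t = 0.

(* kermx is a row kernel, whence the transpositions: the columns of K t span
   the space of the vectors v with A2hat t *m v = 0. *)
Definition admissible_K (r : nat) (Z2 : R -> 'M[R]_(N, a))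
    (K : R -> 'M[R]_(n, d)) : Prop :=
  CkMx I r K /\
  forall t, I t ->
    \rank (K t) = d /\ ((K t)^T == kermx (A2hat Z2 t)^T)%MS.

Definition admissible_Z1 (r : nat) (K Z1 : R -> 'M[R]_(n, d)) : Prop :=
  CkMx I r Z1 /\
  forall t, I t ->
    \rank (Z1 t) = d /\ \rank ((Z1 t)^T *m E t *m K t) = d.

Definition admissible (r : nat) (Z2 : R -> 'M[R]_(N, a))
    (K Z1 : R -> 'M[R]_(n, d)) : Prop :=
  [/\ admissible_Z2 r Z2, admissible_K r Z2 K & admissible_Z1 r K Z1].

(* The first condition is rank Mmu = (mu + 1) n - a, free of the truncated
   subtraction. *)
Definition hypothesis_H (r : nat) : Prop :=
  (forall t, I t -> (\rank (Mmu t) + a)%N = (mu.+1 * n)%N) /\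
  exists2 Z2 : R -> 'M[R]_(N, a), admissible_Z2 r Z2 &
  (forall t, I t -> \rank (A2hat Z2 t) = a) /\
  exists2 K : R -> 'M[R]_(n, d), admissible_K r Z2 K &
  (forall t, I t -> \rank (E t *m K t) = d) /\
  exists Z1 : R -> 'M[R]_(n, d), admissible_Z1 r K Z1.

Definition skew_adjoint : Prop :=
  forall t, I t -> (E t)^T = E t /\ (A t)^T = - A t - derivMx I E t.

Definition restricted_class (had : (d + a)%N = n) (r : nat) (S : 'M[R]_d)
    (Z2 : R -> 'M[R]_(N, a)) (Q : R -> 'M[R]_n)
    (T2 : R -> 'M[R]_(n, d)) (T2' : R -> 'M[R]_(n, a)) : Prop :=
  [/\ forall t, I t -> Q t = castmx (erefl n, had) (row_mx (T2 t) (T2' t)),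
      CkMx I r Q /\ (forall t, I t -> Q t \in unitmx),
      forall t, I t -> A2hat Z2 t *m T2' t \in unitmx
    & exists V : R -> 'M[R]_(n, d), exists W : R -> 'M[R]_d,
      [/\ CkMx I r V,
          forall t, I t -> (V t)^T *m V t = 1%:M
                           /\ ((V t)^T == kermx (A2hat Z2 t)^T)%MS,
          CkMx I r W /\ (forall t, I t -> W t \in unitmx),
          forall t, I t -> (W t)^T *m (V t)^T *m E t *m V t *m W t = S
        & forall t, I t -> T2 t = V t *m W t]].

End LinearDAE.

Definition signature_mx (R : realType) (p q : nat) : 'M[R]_(p + q) :=
  block_mx 1%:M 0 0 (- 1%:M).

Section Flow.
Variables (R : realType) (I : set R) (d : nat).

Definition fundamental_solution (Atil : R -> 'M[R]_d) (t0 : R)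
    (Phi : R -> 'M[R]_d) : Prop :=
  (forall t, I t -> diffMx I Phi t /\ derivMx I Phi t = Atil t *m Phi t)
  /\ Phi t0 = 1%:M.

(* Existence of Phi is included so that the invariance is not vacuous. *)
Definition generalized_orthogonal_flow (S : 'M[R]_d) (Atil : R -> 'M[R]_d) :
    Prop :=
  forall t0, I t0 ->
    (exists Phi, fundamental_solution Atil t0 Phi) /\
    forall Phi, fundamental_solution Atil t0 Phi ->
      forall t, I t -> (Phi t)^T *m S *m Phi t = S.

End Flow.

(* Main.v *)
Require Import Defs.
From HB Require Import structures.
From mathcomp Require Import all_boot all_order all_algebra.
From mathcomp Require Import all_classical all_reals all_analysis.
From mathcomp Require Import ring lra.

Set Implicit Arguments.
Unset Strict Implicit.
Unset Printing Implicit Defensive.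

Import Order.TTheory GRing.Theory Num.Theory.
Import numFieldNormedType.Exports.
Local Open Scope classical_set_scope.
Local Open Scope ring_scope.

(* Write L x = E x' - A x.  A vector x0 lies in ker A2hat(t) iff it is the value at
   t of a polynomial x whose L x vanishes to order mu at t, so ker A2hat can be
   studied by successive reduction of the pencil.  On a subinterval where the rank
   of E is constant, B x = 0 with B = B0 A (B0 the left kernel of E) are the
   algebraic equations visible at first order; restricting L to ker B gives a
   smaller square pencil with one derivative less.  After mu + 1 steps the leading
   matrix is nonsingular, and going back up one gets, on a subinterval of any given
   interval,
   - L K has columns in the range of E K, K being a basis of ker A2hat;
   - a row function xi with (xi E)' = - xi A and xi E K = 0 satisfies xi E = 0.
   The first property is closed, hence holds on the whole interval, and a linear ODE
   yields Phi with L T = 0 for T = K Phi.  Skew-adjointness makes G0 = T^T E T constant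
   and makes every combination of the rows of T^T a solution of the adjoint equation,
   so that the second property shows that G0 is nonsingular.  By Sylvester's law
   C^T G0 C = S; with T2 = T C one has L T2 = 0, so the inherent ODE is x1' = ftil and
   its flow is the identity.  An orthonormal V is obtained from K by parallel transport
   (a second linear ODE), and W = V^T T2. *)

(** * One-sided derivatives on a compact interval *)

(** The obstacle is that [E] may change rank on the interval: only the derivative array has constant
    rank, so the pencil cannot be reduced globally. Two facts are carried back from the
    subintervals. The range condition must hold at every point; its only possible coefficient is X =
    (Z1^T E K)^-1 Z1^T L K, which is continuous on the whole interval, so the identity extends from
    a dense set. The separation property is needed at one point only, because G0 is constant.
    Hypothesis (H) enters the reduction as two pointwise properties of jets: rank A2hat = a makes L
    onto on jets, and rank E K = d makes every jet solution x with E x = 0 vanish. Both pass to the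
    reduced pencil. The second makes the last leading matrix invertible, since at order 0 every
    vector is a jet solution. *)

Definition is_dI (R : realType) (I : set R) (g : R -> R) (t l : R) : Prop :=
  diff_quot g t @ within I t^' --> l.

Section DerivativeOnInterval.
Variables (R : realType) (a b : R).
Hypothesis ab : a < b.
Local Notation I := `[a, b]%classic.

(** Each point of a nondegenerate interval, endpoints included, is an accumulation point of it; this
    makes the one-sided limits, hence [derivI], unique. *)
Lemma dnbhs_within_itv_proper t : I t -> ProperFilter (within I t^').
Proof.
move=> /= It; apply: Build_ProperFilter_ex => P [e /= e0 H].
have [h [h0 he Ih]] : exists h, [/\ h != 0, `|h| < e & I (t + h)].
  have m (u : R) : 0 < u -> exists h : R, [/\ 0 < h, h < e & h <= u].
    move=> u0; exists (Num.min (e / 2) u); split; last by rewrite ge_min lexx orbT.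
      by rewrite lt_min u0 divr_gt0.
    by rewrite gt_min; apply/orP; left; lra.
  rewrite /= in_itv /= in It; case/andP: It => It1 It2.
  have [tb|tb] := ltP t b.
    have [|h [h0 he hb]] := m (b - t); first by lra.
    exists h; rewrite gt_eqF// gtr0_norm//; split => //.
    by rewrite /= in_itv /=; apply/andP; split; lra.
  have [|h [h0 he hb]] := m (b - a); first by rewrite subr_gt0.
  exists (- h); rewrite oppr_eq0 gt_eqF// normrN gtr0_norm//; split => //.
  by rewrite /= in_itv /=; apply/andP; split; lra.
exists (t + h); apply: (H (t + h)) => //=.
  by rewrite opprD addrA subrr add0r normrN.
by rewrite addrC -subr_eq0 addrK.
Qed.

Lemma cvg_dnbhs_within_ext (f g : R -> R) t (l : R) :
  (forall s, I s -> s != t -> f s = g s) ->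
  f @ within I t^' --> l -> g @ within I t^' --> l.
Proof.
move=> fg fl P Pl; have := fl P Pl; apply: filterS2 (@nbhs_dnbhs_neq _ t) => s st W Is.
by rewrite /= -fg//; exact: W.
Qed.

Lemma is_dI_cvg g t l : is_dI I g t l -> diffI I g t.
Proof. by move=> H; apply/cvg_ex; exists l. Qed.

Lemma is_dI_derivI g t l : I t -> is_dI I g t l -> derivI I g t = l.
Proof.
move=> It H; have F := dnbhs_within_itv_proper It.
exact: (cvg_lim (@Rhausdorff _) H).
Qed.

Lemma derivIP g t : I t -> diffI I g t -> is_dI I g t (derivI I g t).
Proof. by []. Qed.

Lemma is_dI_eq g t l l' : is_dI I g t l -> l = l' -> is_dI I g t l'.
Proof. by move=> + <-. Qed.

Lemma is_dI_ext f g t l :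
  (forall s, I s -> f s = g s) -> I t -> is_dI I f t l -> is_dI I g t l.
Proof.
move=> fg It; rewrite /is_dI; apply: cvg_dnbhs_within_ext => s Is st.
by rewrite /diff_quot !fg.
Qed.


Lemma cvg_dnbhs_within_itv t : s @[s --> within I t^'] --> t.
Proof.
move=> P /nbhs_dnbhs H; rewrite /nbhs /= /within /=.
by move: H; apply: filterS.
Qed.

Lemma is_dI_continuous g t l : is_dI I g t l ->
  g @ within I t^' --> g t.
Proof.
move=> H.
have : (fun s => g t + (s - t) * diff_quot g t s) @ within I t^' --> g t + (t - t) * l.
  apply: cvgD; first exact: cvg_cst.
  apply: cvgM H; apply: cvgB; [exact: cvg_dnbhs_within_itv|exact: cvg_cst].
rewrite subrr mul0r addr0; apply: cvg_dnbhs_within_ext => s Is st.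
by rewrite /diff_quot mulrC divfK ?subr_eq0// addrC subrK.
Qed.

Lemma diffI_continuous g : (forall t, I t -> diffI I g t) -> {within I, continuous g}.
Proof.
move=> H; apply/subspace_continuousP => t It.
move=> P Pg.
have H1 : nbhs (t : R) [set s | s != t -> I s -> P (g s)].
  exact: is_dI_continuous (derivIP It (H t It)) P Pg.
suff : nbhs (t : R) [set s | I s -> P (g s)] by [].
apply: filterS H1 => s W Is.
by have [->|st] := eqVneq s t; [exact: nbhs_singleton|exact: W].
Qed.

Lemma is_dI_cst c t : is_dI I (fun=> c) t 0.
Proof.
rewrite /is_dI /diff_quot subrr.
under eq_fun do rewrite mul0r.
exact: cvg_cst.
Qed.

Lemma is_dI_id t : is_dI I id t 1.
Proof.
apply: cvg_dnbhs_within_ext (cvg_cst (1 : R)) => s Is st.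
by rewrite /diff_quot divff// subr_eq0.
Qed.

Lemma is_dID f g t k l : is_dI I f t k -> is_dI I g t l ->
  is_dI I (fun s => f s + g s) t (k + l).
Proof.
move=> hf hg; apply: cvg_dnbhs_within_ext (cvgD hf hg) => s Is st.
by rewrite ?fctE /= /diff_quot; ring.
Qed.

Lemma is_dIM f g t k l : is_dI I f t k -> is_dI I g t l ->
  is_dI I (fun s => f s * g s) t (k * g t + f t * l).
Proof.
move=> hf hg.
apply: cvg_dnbhs_within_ext
  (cvgD (cvgM hf (is_dI_continuous hg)) (cvgM (cvg_cst (f t)) hg)) => s Is st.
by rewrite ?fctE /= /diff_quot; ring.
Qed.

Lemma is_dIV f t k : (forall s, I s -> f s != 0) -> I t -> is_dI I f t k ->
  is_dI I (fun s => (f s)^-1) t (- k / (f t) ^+ 2).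
Proof.
move=> f0 It hf.
rewrite expr2; apply: cvg_dnbhs_within_ext
  (cvgM (cvgN hf) (cvgV (mulf_neq0 (f0 _ It) (f0 _ It))
    (cvgM (is_dI_continuous hf) (cvg_cst (f t))))) => s Is st.
rewrite ?fctE /= /diff_quot.
have s0 : s - t != 0 by rewrite subr_eq0.
have f1 := f0 _ Is; have f2 := f0 _ It.
by field; rewrite f1 f2 s0.
Qed.

Lemma continuous_itvP (g : R -> R) : {within I, continuous g} <->
  forall t : R, I t -> g @ within I (nbhs t) --> g t.
Proof. exact: subspace_continuousP. Qed.

Lemma CkI_ext k f g : (forall s, I s -> f s = g s) -> CkI I k f -> CkI I k g.
Proof.
elim: k f g => [|k IH] f g fg /=.
  move=> /continuous_itvP H; apply/continuous_itvP => t It; rewrite -fg// => P Pl.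
  have H1 : nbhs (t : R) [set s | I s -> P (f s)] by exact: H t It P Pl.
  suff : nbhs (t : R) [set s | I s -> P (g s)] by [].
  by apply: filterS H1 => s W Is; rewrite -fg//; exact: W.
move=> [df cf]; have dg t (It : I t) : is_dI I g t (derivI I f t).
  exact: is_dI_ext fg It (derivIP It (df t It)).
split=> [t It|]; first exact: is_dI_cvg (dg t It).
by apply: IH cf => s Is; rewrite (is_dI_derivI Is (dg s Is)).
Qed.

(** [derivI] is controlled only at points of the interval, so a candidate derivative known there may
    replace it. The inductive closure properties below rest on this. *)
Lemma CkIS k f f' : (forall t, I t -> is_dI I f t (f' t)) -> CkI I k f' -> CkI I k.+1 f.
Proof.
move=> H c; split=> [t It|]; first exact: is_dI_cvg (H t It).
by apply: CkI_ext c => t It; rewrite (is_dI_derivI It (H t It)).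
Qed.

Lemma CkIW k f : CkI I k.+1 f -> CkI I k f.
Proof.
elim: k f => [|k IH] f; first by move=> [df _]; exact: diffI_continuous.
by move=> [df cf]; split => //; exact: IH.
Qed.

Lemma CkI_le j k f : (j <= k)%N -> CkI I k f -> CkI I j f.
Proof.
by move=> /subnK <-; elim: (k - j)%N => // i IH; rewrite addSn => /CkIW.
Qed.

Lemma CkI_dI k f t : CkI I k.+1 f -> I t -> is_dI I f t (derivI I f t).
Proof. by move=> [df _] It; exact: derivIP It (df t It). Qed.

Lemma CkI_cst k c : CkI I k (fun=> c).
Proof.
elim: k c => [|k IH] c; first by apply/continuous_itvP => t _; exact: cvg_cst.
by apply: (@CkIS k _ (fun=> 0)) => // t It; exact: is_dI_cst.
Qed.

Lemma CkID k f g : CkI I k f -> CkI I k g -> CkI I k (fun s => f s + g s).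
Proof.
elim: k f g => [|k IH] f g.
  move=> /continuous_itvP cf /continuous_itvP cg; apply/continuous_itvP => t It.
  by apply: cvgD; [exact: cf|exact: cg].
move=> cf cg; apply: (@CkIS k _ (fun t => derivI I f t + derivI I g t)).
  by move=> t It; apply: is_dID; apply: CkI_dI It; eassumption.
by apply: IH; [exact: cf.2|exact: cg.2].
Qed.

Lemma CkIM k f g : CkI I k f -> CkI I k g -> CkI I k (fun s => f s * g s).
Proof.
elim: k f g => [|k IH] f g.
  move=> /continuous_itvP cf /continuous_itvP cg; apply/continuous_itvP => t It.
  by apply: cvgM; [exact: cf|exact: cg].
move=> cf cg; apply: (@CkIS k _ (fun t => derivI I f t * g t + f t * derivI I g t)).
  by move=> t It; apply: is_dIM; apply: CkI_dI It; eassumption.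
apply: CkID; apply: IH; [exact: cf.2|exact: CkIW cg|exact: CkIW cf|exact: cg.2].
Qed.

Lemma CkIN k f : CkI I k f -> CkI I k (fun s => - f s).
Proof.
move=> cf; apply: CkI_ext (CkIM (CkI_cst k (-1)) cf) => s _.
by rewrite mulN1r.
Qed.

Lemma CkIV k f : (forall s, I s -> f s != 0) -> CkI I k f -> CkI I k (fun s => (f s)^-1).
Proof.
move=> f0; elim: k => [|k IH] cf.
  move/continuous_itvP : cf => cf; apply/continuous_itvP => t It.
  by apply: cvgV; [exact: f0|exact: cf].
apply: (@CkIS k _ (fun t => - derivI I f t * ((f t)^-1 * (f t)^-1))).
  move=> t It; apply: is_dI_eq; first by apply: (is_dIV _ It (CkI_dI cf It)).
  by rewrite expr2 invfM.
apply: CkIM; first exact: CkIN cf.2.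
by apply: CkIM; apply: IH; exact: CkIW.
Qed.

Lemma CkI_sum k (J : Type) (r : seq J) (P : pred J) (F : J -> R -> R) :
  (forall j, P j -> CkI I k (F j)) -> CkI I k (fun s => \sum_(j <- r | P j) F j s).
Proof.
move=> H; elim: r => [|j r IH].
  by apply: CkI_ext (CkI_cst k 0) => s _; rewrite big_nil.
case/boolP: (P j) => Pj; last by apply: CkI_ext IH => s _; rewrite big_cons (negbTE Pj).
by apply: CkI_ext (CkID (H j Pj) IH) => s _; rewrite big_cons Pj.
Qed.

Lemma CkI_prod k (J : Type) (r : seq J) (P : pred J) (F : J -> R -> R) :
  (forall j, P j -> CkI I k (F j)) -> CkI I k (fun s => \prod_(j <- r | P j) F j s).
Proof.
move=> H; elim: r => [|j r IH].
  by apply: CkI_ext (CkI_cst k 1) => s _; rewrite big_nil.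
case/boolP: (P j) => Pj; last by apply: CkI_ext IH => s _; rewrite big_cons (negbTE Pj).
by apply: CkI_ext (CkIM (H j Pj) IH) => s _; rewrite big_cons Pj.
Qed.

Lemma is_dI_sum (J : Type) (r : seq J) (P : pred J) (F : J -> R -> R) (F' : J -> R) t :
  (forall j, P j -> is_dI I (F j) t (F' j)) ->
  is_dI I (fun s => \sum_(j <- r | P j) F j s) t (\sum_(j <- r | P j) F' j).
Proof.
move=> H; elim: r => [|j r IH].
  have -> : (fun s => \sum_(j <- [::] | P j) F j s) = fun=> 0.
    by apply/funext => s; rewrite big_nil.
  by rewrite big_nil; exact: is_dI_cst.
have -> : (fun s => \sum_(j <- j :: r | P j) F j s) =
    fun s => (if P j then F j s else 0) + \sum_(j <- r | P j) F j s.
  by apply/funext => s; rewrite big_cons; case: ifP => // _; rewrite add0r.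
rewrite big_cons; case: ifP => Pj; first by apply: is_dID IH; exact: H.
by rewrite -[X in is_dI _ _ _ X]add0r; apply: is_dID IH; exact: is_dI_cst.
Qed.

End DerivativeOnInterval.


Section DerivativeFullNbhs.
Variables (R : realType).

Lemma is_derive_diff_quot (f : R -> R) (t l : R) :
  diff_quot f t @ t^' --> l -> is_derive t 1 f l.
Proof.
move=> H.
have K : (fun h : R => h^-1 *: ((f \o shift t) (h *: (1 : R)) - f t)) @ 0^' --> l.
  move=> P Pl; have [e /= e0 He] := H P Pl; exists e => //= h /= he h0.
  have := He (h + t); rewrite /= opprD addrCA subrr addr0 => /(_ _ _) Hh.
  rewrite /shift /= scaler1 /GRing.scale /= mulrC.
  have := Hh; rewrite /diff_quot addrK; apply.
    by move: he; rewrite sub0r.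
  by rewrite -subr_eq0 addrK.
split; first by apply/cvg_ex; exists l.
exact: (cvg_lim (@Rhausdorff _) K).
Qed.

Lemma diff_quot_derivable (f : R -> R) (t : R) :
  derivable f t 1 -> diff_quot f t @ t^' --> 'D_1 f t.
Proof.
move=> H P Pl; have [e /= e0 He] := H P Pl; exists e => //= s /= se st.
have := He (s - t); rewrite /= /shift /= scaler1 subrK => Hh.
rewrite /diff_quot mulrC; apply: Hh.
  by rewrite sub0r opprB.
by rewrite subr_eq0.
Qed.

End DerivativeFullNbhs.

Section MeanValue.
Variables (R : realType).

Lemma sub_itv_cc (a b c d : R) : a <= c -> d <= b ->
  forall t, `[c, d]%classic t -> `[a, b]%classic t.
Proof. by move=> ac db t /=; rewrite !in_itv /= => /andP[? ?]; apply/andP; split; lra. Qed.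

Lemma is_dI_sub (I J : set R) (f : R -> R) (t l : R) :
  (forall s, J s -> I s) -> is_dI I f t l -> is_dI J f t l.
Proof.
move=> JI H P Pl; have := H P Pl => H1.
have {}H1 : nbhs t [set s | s != t -> I s -> P (diff_quot f t s)] by [].
suff : nbhs t [set s | s != t -> J s -> P (diff_quot f t s)] by [].
by apply: filterS H1 => s W st Js; apply: W => //; exact: JI.
Qed.

Variables (a b c d : R).
Hypotheses (ab : a < b) (cd : c < d) (ac : a <= c) (db : d <= b).
Local Notation I := `[a, b]%classic.
Local Notation J := `[c, d]%classic.

Lemma continuous_sub (f : R -> R) : {within I, continuous f} -> {within J, continuous f}.
Proof.
move=> /continuous_itvP cf; apply/continuous_itvP => t Jt P Pl.
have H1 : nbhs t [set s | I s -> P (f s)] by apply: (cf t) => //; exact: sub_itv_cc Jt.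
suff : nbhs t [set s | J s -> P (f s)] by [].
by apply: filterS H1 => s W Js; apply: W; exact: sub_itv_cc Js.
Qed.

Lemma CkI_sub k (f : R -> R) : CkI I k f -> CkI J k f.
Proof.
elim: k f => [|k IH] f; first exact: continuous_sub.
move=> cf; apply: (@CkIS _ _ _ cd _ _ (derivI I f)); last by apply: IH; exact: cf.2.
move=> t Jt; apply: (@is_dI_sub I); first by move=> s; exact: sub_itv_cc.
by apply: (CkI_dI cf); exact: sub_itv_cc Jt.
Qed.

Lemma derivI_sub (f : R -> R) t : J t -> diffI I f t -> derivI J f t = derivI I f t.
Proof.
move=> Jt df; apply: is_dI_derivI => //; apply: (@is_dI_sub I).
  by move=> s; exact: sub_itv_cc.
by apply: derivIP => //; exact: sub_itv_cc Jt.
Qed.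

End MeanValue.

Section Monotone.
Variables (R : realType) (a b : R).
Hypothesis ab : a < b.
Local Notation I := `[a, b]%classic.

Lemma is_dI_is_derive (f : R -> R) t l : t \in `]a, b[ -> is_dI I f t l -> is_derive t 1 f l.
Proof.
rewrite in_itv /= => /andP[at_ tb] H; apply: is_derive_diff_quot => P Pl.
have H1 : nbhs t [set s | s != t -> I s -> P (diff_quot f t s)] by exact: H.
suff : nbhs t [set s | s != t -> P (diff_quot f t s)] by [].
apply: filterS3 H1 (lt_nbhsr at_) (lt_nbhsl tb) => s H1 s1 s2 st; apply: H1 => //.
by rewrite /= in_itv /= !ltW.
Qed.

Lemma le_is_dI (f f' : R -> R) :
  (forall t, I t -> is_dI I f t (f' t)) -> (forall t, I t -> 0 <= f' t) ->
  forall s t, I s -> I t -> s <= t -> f s <= f t.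
Proof.
move=> H f0 s t; rewrite /= !in_itv /= => /andP[as_ sb] /andP[at_ tb] st.
have := @MVT_segment R f f' s t st; case.
- move=> x; rewrite in_itv /= => /andP[sx xt]; apply: is_dI_is_derive.
    by rewrite in_itv /=; apply/andP; split; lra.
  by apply: H; rewrite /= in_itv /=; apply/andP; split; lra.
- apply: (@continuous_sub R a b) => //.
  by apply: diffI_continuous => // x Ix; exact: is_dI_cvg (H x Ix).
- move=> x; rewrite in_itv /= => /andP[sx xt] E; rewrite -subr_ge0 E mulr_ge0 ?subr_ge0//.
  by apply: f0; rewrite /= in_itv /=; apply/andP; split; lra.
Qed.

Lemma is_dI0_cst (f : R -> R) : (forall t, I t -> is_dI I f t 0) ->
  forall s t, I s -> I t -> f s = f t.
Proof.
move=> H.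
have H' t : I t -> is_dI I (fun s => -1 * f s) t 0.
  move=> It; apply: is_dI_eq; first by apply: is_dIM (H t It); exact: is_dI_cst.
  by rewrite mul0r mulr0 addr0.
have K s t : I s -> I t -> s <= t -> f s = f t.
  move=> Is It st; apply/eqP; rewrite eq_le (le_is_dI H)//=.
  by have := le_is_dI H' (fun _ _ => lexx 0) Is It st; rewrite !mulN1r lerN2.
by move=> s t Is It; case: (leP s t) => [|/ltW] st; [exact: K|apply/esym; exact: K].
Qed.

Lemma clamp_lipschitz (x y : R) :
  `|Num.max a (Num.min x b) - Num.max a (Num.min y b)| <= `|x - y|.
Proof.
wlog xy : x y / x <= y.
  by move=> W; case: (leP x y) => [|/ltW] xy; [|rewrite distrC [leRHS]distrC]; exact: W.
rewrite [leRHS]distrC [leRHS]ger0_norm ?subr_ge0//.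
have [h1|h1] := leP x b; have [h2|h2] := leP y b;
  rewrite ?(min_l h1) ?(min_r (ltW h1)) ?(min_l h2) ?(min_r (ltW h2));
  rewrite ?subrr ?normr0 ?subr_ge0//;
  rewrite !maxEle; case: ifPn => h3; case: ifPn => h4; rewrite -?ltNge in h3 h4;
  by rewrite ler_norml; apply/andP; split; lra.
Qed.

(** The function is extended to the whole line by its endpoint values, so that the two-sided
    fundamental theorem of calculus applies at the endpoints as well. *)
Lemma primitive_exists (g : R -> R) : {within I, continuous g} ->
  exists2 G, G a = 0 & forall t, I t -> is_dI I G t (g t).
Proof.
move=> cg.
pose h (t : R) := g (Num.max a (Num.min t b)).
have hg t : I t -> h t = g t.
  rewrite /= in_itv /= /h => /andP[at_ tb].
  by rewrite (min_idPl _)// (max_idPr _).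
have ch : continuous h.
  move=> t; have It : I (Num.max a (Num.min t b)).
    by rewrite /= in_itv /= le_max lexx /= ge_max (ltW ab) ge_min lexx orbT.
  move=> P Pl; have H1 : nbhs (Num.max a (Num.min t b)) [set s | I s -> P (g s)].
    by move/continuous_itvP : cg => /(_ _ It); exact.
  have [e /= e0 He] := H1.
  exists e => //= s /= se; apply: He => /=; last first.
    by rewrite in_itv /= le_max lexx /= ge_max (ltW ab) ge_min lexx orbT.
  exact: le_lt_trans (clamp_lipschitz _ _) se.
(* Starting at a - 1 makes [a] an interior point of the range of integration; subtracting F a
   restores the normalization. *)
pose F (x : R) := (\int[lebesgue_measure]_(t in [set` `[a - 1, x]]) (h t))%R.
have dF t : I t -> derivable F t 1 /\ derive1 F t = h t.
  rewrite /= in_itv /= => /andP[at_ tb].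
  apply: (@continuous_FTC1_closed R h (a - 1) t (b + 1)).
  - by lra.
  - apply: continuous_compact_integrable; first exact: segment_compact.
    by apply: continuous_subspaceT.
  - by lra.
  - exact: ch.
exists (fun t => F t - F a); first by rewrite subrr.
move=> t It; have [d1 d2] := dF t It.
have := diff_quot_derivable d1; rewrite -derive1E d2 hg// => d3.
rewrite -[g t]addr0; apply: is_dID; last exact: is_dI_cst.
move=> P Pl; have := d3 P Pl => d4.
have {}d4 : nbhs t [set s | s != t -> P (diff_quot F t s)] by [].
suff : nbhs t [set s | s != t -> I s -> P (diff_quot F t s)] by [].
by apply: filterS d4 => s W st _; exact: W.
Qed.

End Monotone.


(** * Matrix-valued functions *)

Definition is_dMx (R : realType) (I : set R) (m n : nat)
    (X : R -> 'M[R]_(m, n)) (t : R) (X' : 'M[R]_(m, n)) : Prop :=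
  forall i j, is_dI I (fun s => X s i j) t (X' i j).

Section MatrixCalculus.
Variables (R : realType) (a b : R).
Hypothesis ab : a < b.
Local Notation I := `[a, b]%classic.

Lemma is_dMx_derivMx m n (X : R -> 'M[R]_(m, n)) t X' :
  I t -> is_dMx I X t X' -> derivMx I X t = X'.
Proof. by move=> It H; apply/matrixP => i j; rewrite mxE; exact: is_dI_derivI (H i j). Qed.

Lemma CkMx_dMx k m n (X : R -> 'M[R]_(m, n)) t :
  CkMx I k.+1 X -> I t -> is_dMx I X t (derivMx I X t).
Proof. by move=> H It i j; rewrite mxE; exact: CkI_dI (H i j) It. Qed.

Lemma is_dMx_eq m n (X : R -> 'M[R]_(m, n)) t X' X'' :
  is_dMx I X t X' -> X' = X'' -> is_dMx I X t X''.
Proof. by move=> + <-. Qed.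

Lemma is_dMx_ext m n (X Y : R -> 'M[R]_(m, n)) t X' :
  (forall s, I s -> X s = Y s) -> I t -> is_dMx I X t X' -> is_dMx I Y t X'.
Proof. by move=> XY It H i j; apply: is_dI_ext It (H i j) => s Is; rewrite XY. Qed.

Lemma is_dMx_cst m n (C : 'M[R]_(m, n)) t : is_dMx I (fun=> C) t 0.
Proof. by move=> i j; rewrite mxE; exact: is_dI_cst. Qed.

Lemma is_dMxD m n (X Y : R -> 'M[R]_(m, n)) t X' Y' :
  is_dMx I X t X' -> is_dMx I Y t Y' -> is_dMx I (fun s => X s + Y s) t (X' + Y').
Proof.
move=> hX hY i j; rewrite mxE.
have -> : (fun s => (X s + Y s) i j) = fun s => X s i j + Y s i j.
  by apply/funext => s; rewrite mxE.
exact: is_dID (hX i j) (hY i j).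
Qed.

Lemma is_dMxM m n p (X : R -> 'M[R]_(m, n)) (Y : R -> 'M[R]_(n, p)) t X' Y' :
  is_dMx I X t X' -> is_dMx I Y t Y' ->
  is_dMx I (fun s => X s *m Y s) t (X' *m Y t + X t *m Y').
Proof.
move=> hX hY i j.
have -> : (fun s => (X s *m Y s) i j) = fun s => \sum_k X s i k * Y s k j.
  by apply/funext => s; rewrite mxE.
apply: is_dI_eq; first by apply: is_dI_sum => k _; exact: is_dIM (hX i k) (hY k j).
by rewrite !mxE -big_split.
Qed.

Lemma is_dMxMl m n p (C : 'M[R]_(m, n)) (Y : R -> 'M[R]_(n, p)) t Y' :
  is_dMx I Y t Y' -> is_dMx I (fun s => C *m Y s) t (C *m Y').
Proof.
move=> hY; apply: is_dMx_eq; first exact: is_dMxM (is_dMx_cst C t) hY.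
by rewrite mul0mx add0r.
Qed.

Lemma is_dMxMr m n p (X : R -> 'M[R]_(m, n)) (C : 'M[R]_(n, p)) t X' :
  is_dMx I X t X' -> is_dMx I (fun s => X s *m C) t (X' *m C).
Proof.
move=> hX; apply: is_dMx_eq; first exact: is_dMxM hX (is_dMx_cst C t).
by rewrite mulmx0 addr0.
Qed.

Lemma is_dMxN m n (X : R -> 'M[R]_(m, n)) t X' :
  is_dMx I X t X' -> is_dMx I (fun s => - X s) t (- X').
Proof.
move=> hX; have := is_dMxMl (C := - 1%:M) hX; rewrite mulNmx mul1mx.
by congr is_dMx; apply/funext => s; rewrite mulNmx mul1mx.
Qed.

Lemma is_dMxB m n (X Y : R -> 'M[R]_(m, n)) t X' Y' :
  is_dMx I X t X' -> is_dMx I Y t Y' -> is_dMx I (fun s => X s - Y s) t (X' - Y').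
Proof. by move=> hX hY; exact: is_dMxD hX (is_dMxN hY). Qed.

Lemma is_dMxT m n (X : R -> 'M[R]_(m, n)) t X' :
  is_dMx I X t X' -> is_dMx I (fun s => (X s)^T) t X'^T.
Proof.
move=> hX i j; rewrite mxE.
have -> : (fun s => (X s)^T i j) = fun s => X s j i by apply/funext => s; rewrite mxE.
exact: hX.
Qed.

Lemma is_dMx0_cst m n (X : R -> 'M[R]_(m, n)) :
  (forall t, I t -> is_dMx I X t 0) -> forall s t, I s -> I t -> X s = X t.
Proof.
move=> H s t Is It; apply/matrixP => i j.
have K u : I u -> is_dI I (fun u => X u i j) u 0 by move=> Iu; have := H u Iu i j; rewrite mxE.
exact: (is_dI0_cst K Is It).
Qed.

Lemma CkMx_ext k m n (X Y : R -> 'M[R]_(m, n)) :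
  (forall s, I s -> X s = Y s) -> CkMx I k X -> CkMx I k Y.
Proof. by move=> XY H i j; apply: CkI_ext (H i j) => // s Is; rewrite XY. Qed.

Lemma CkMx_le j k m n (X : R -> 'M[R]_(m, n)) : (j <= k)%N -> CkMx I k X -> CkMx I j X.
Proof. by move=> jk H i i'; exact: CkI_le (H i i'). Qed.

Lemma CkMx_cst k m n (C : 'M[R]_(m, n)) : CkMx I k (fun=> C).
Proof. by move=> i j; exact: CkI_cst. Qed.

Lemma CkMxD k m n (X Y : R -> 'M[R]_(m, n)) :
  CkMx I k X -> CkMx I k Y -> CkMx I k (fun s => X s + Y s).
Proof.
by move=> hX hY i j; apply: CkI_ext (CkID ab (hX i j) (hY i j)) => // s _; rewrite mxE.
Qed.

Lemma CkMxM k m n p (X : R -> 'M[R]_(m, n)) (Y : R -> 'M[R]_(n, p)) :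
  CkMx I k X -> CkMx I k Y -> CkMx I k (fun s => X s *m Y s).
Proof.
move=> hX hY i j; apply: (@CkI_ext _ _ _ ab _ (fun s => \sum_l X s i l * Y s l j)).
  by move=> s _; rewrite mxE.
by apply: CkI_sum => // l _; exact: CkIM.
Qed.

Lemma CkMxN k m n (X : R -> 'M[R]_(m, n)) : CkMx I k X -> CkMx I k (fun s => - X s).
Proof. by move=> hX i j; apply: CkI_ext (CkIN ab (hX i j)) => // s _; rewrite mxE. Qed.

Lemma CkMxB k m n (X Y : R -> 'M[R]_(m, n)) :
  CkMx I k X -> CkMx I k Y -> CkMx I k (fun s => X s - Y s).
Proof. by move=> hX hY; exact: CkMxD hX (CkMxN hY). Qed.

Lemma CkMxT k m n (X : R -> 'M[R]_(m, n)) : CkMx I k X -> CkMx I k (fun s => (X s)^T).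
Proof. by move=> hX i j; apply: CkI_ext (hX j i) => // s _; rewrite mxE. Qed.

Lemma CkMx_deriv k m n (X : R -> 'M[R]_(m, n)) : CkMx I k.+1 X -> CkMx I k (derivMx I X).
Proof.
by move=> H i j; apply: CkI_ext (H i j).2 => // s Is; rewrite mxE.
Qed.

Lemma CkMxS k m n (X X' : R -> 'M[R]_(m, n)) :
  (forall t, I t -> is_dMx I X t (X' t)) -> CkMx I k X' -> CkMx I k.+1 X.
Proof. by move=> H c i j; apply: (CkIS ab) (c i j) => t It; exact: H. Qed.

Lemma CkMx_row k m n1 n2 (X : R -> 'M[R]_(m, n1)) (Y : R -> 'M[R]_(m, n2)) :
  CkMx I k X -> CkMx I k Y -> CkMx I k (fun s => row_mx (X s) (Y s)).
Proof.
move=> hX hY i j; case: (splitP j) => l jl.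
  have {jl}-> : j = lshift n2 l by apply/val_inj.
  by apply: CkI_ext (hX i l) => // s _; rewrite row_mxEl.
have {jl}-> : j = rshift n1 l by apply/val_inj.
by apply: CkI_ext (hY i l) => // s _; rewrite row_mxEr.
Qed.

Lemma CkMx_col k m1 m2 n (X : R -> 'M[R]_(m1, n)) (Y : R -> 'M[R]_(m2, n)) :
  CkMx I k X -> CkMx I k Y -> CkMx I k (fun s => col_mx (X s) (Y s)).
Proof.
move=> hX hY; apply: CkMx_ext (CkMxT (CkMx_row (CkMxT hX) (CkMxT hY))) => s _.
by rewrite tr_row_mx !trmxK.
Qed.

Lemma CkI_det k n (X : R -> 'M[R]_n) : CkMx I k X -> CkI I k (fun s => \det (X s)).
Proof.
move=> hX; apply: CkI_sum => // p _; apply: CkIM => //; first exact: CkI_cst.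
by apply: CkI_prod => // i _; exact: hX.
Qed.

(** Cramer's rule: the entries are cofactors, polynomial in the entries of [X], over a nonvanishing
    determinant. *)
Lemma CkMx_inv k n (X : R -> 'M[R]_n) :
  (forall s, I s -> X s \in unitmx) -> CkMx I k X -> CkMx I k (fun s => invmx (X s)).
Proof.
move=> u hX i j.
apply: (@CkI_ext _ _ _ ab _ (fun s => (\det (X s))^-1 * cofactor (X s) j i)).
  by move=> s Is; rewrite /invmx u// !mxE.
apply: CkIM => //.
  apply: CkIV => //; last exact: CkI_det.
  by move=> s Is; have := u s Is; rewrite unitmxE unitfE.
apply: CkIM => //; first exact: CkI_cst.
apply: CkI_det => i' j'; apply: CkI_ext (hX (lift j i') (lift i j')) => // s _.
by rewrite !mxE.
Qed.

Lemma CkMx_inv_open k n (X : R -> 'M[R]_n) t : CkMx I k X -> I t -> X t \in unitmx ->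
  nbhs t [set s | I s -> X s \in unitmx].
Proof.
move=> hX It ut.
have c0 : CkI I 0 (fun s => \det (X s)) by apply: (CkI_le (leq0n k)); exact: CkI_det.
have {c0}/continuous_itvP cd := c0.
have d0 : nbhs (\det (X t)) [set x : R | x != 0].
  apply: open_nbhs_nbhs; split; last by move: ut; rewrite unitmxE unitfE.
  exact: open_neq.
have : nbhs t [set s | I s -> \det (X s) != 0] by exact: cd d0.
by apply: filterS => s H Is; rewrite unitmxE unitfE; exact: H.
Qed.

End MatrixCalculus.

Lemma exists_sub_itv (R : realType) (a b t : R) (P : R -> Prop) : a < b ->
  `[a, b]%classic t -> nbhs t [set s | `[a, b]%classic s -> P s] ->
  exists c d, [/\ c < d, a <= c, d <= b, `[c, d]%classic t
                & forall s, `[c, d]%classic s -> P s].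
Proof.
rewrite /= in_itv /= => ab /andP[at_ tb] [e /= e0 H].
exists (Num.max a (t - e / 2)), (Num.min b (t + e / 2)); split.
- by rewrite gt_max !lt_min; apply/andP; split; apply/andP; split; lra.
- by rewrite le_max lexx.
- by rewrite ge_min lexx.
- by rewrite /= in_itv /= ge_max le_min at_ tb /=; apply/andP; split; lra.
move=> s; rewrite /= in_itv /= ge_max le_min => /andP[/andP[s1 s2] /andP[s3 s4]].
apply: H; last by rewrite /= in_itv /= s1 s3.
by rewrite /= ltr_norml; apply/andP; split; lra.
Qed.


(** * Flat functions, Taylor polynomials and the Leibniz rule *)

(** Vanishing to order [m]: the derivatives of orders 0 to m - 1 are zero at [t], so m = 0 asks only
    for continuity. Smoothness is bundled in so that flat functions form an ideal among the C^m
    functions. *)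
Definition flat (R : realType) (I : set R) (m : nat) (h : R -> R) (t : R) : Prop :=
  CkI I m h /\ forall i, (i < m)%N -> iter i (derivI I) h t = 0.

Definition flatMx (R : realType) (I : set R) (k m n : nat)
    (X : R -> 'M[R]_(m, n)) (t : R) : Prop :=
  forall i j, flat I k (fun s => X s i j) t.

Definition poly_fun (R : realType) (m n : nat) (X : R -> 'M[R]_(m, n)) : Prop :=
  forall i j, exists p : {poly R}, forall s, X s i j = p.[s].

Section Flat.
Variables (R : realType) (a b : R).
Hypothesis ab : a < b.
Local Notation I := `[a, b]%classic.

Lemma derivI_ext (f g : R -> R) t :
  (forall s, I s -> f s = g s) -> I t -> derivI I f t = derivI I g t.
Proof.
move=> fg It; rewrite /derivI.
have -> // : (diff_quot f t @ within I t^') = (diff_quot g t @ within I t^').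
apply/funext => P; apply/propext.
suff : nbhs t [set s | s != t -> I s -> P (diff_quot f t s)] <->
       nbhs t [set s | s != t -> I s -> P (diff_quot g t s)] by [].
by split; apply: filterS => s W st Is; have := W st Is; rewrite /diff_quot !fg.
Qed.

Lemma iter_derivI_ext i (f g : R -> R) t :
  (forall s, I s -> f s = g s) -> I t -> iter i (derivI I) f t = iter i (derivI I) g t.
Proof. by move=> fg; elim: i t => [|i IH] t It /=; [exact: fg|exact: derivI_ext]. Qed.

Lemma CkI_iter i k (f : R -> R) : CkI I (i + k) f -> CkI I k (iter i (derivI I) f).
Proof. by elim: i f => // i IH f; rewrite addSn iterSr => -[_ /IH]. Qed.

Lemma flatS m h t : flat I m.+1 h t <->
  [/\ h t = 0, forall s, I s -> diffI I h s & flat I m (derivI I h) t].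
Proof.
split=> [[[d c] H]|[h0 d [c H]]].
  by split=> //; [exact: (H 0%N)|split=> // i im; rewrite -iterSr; exact: H].
by split; [split|case=> [|i]//; rewrite ltnS => im; rewrite iterSr; exact: H].
Qed.

Lemma flat_ext m f g t : (forall s, I s -> f s = g s) -> I t -> flat I m f t -> flat I m g t.
Proof.
move=> fg It [c H]; split; first exact: CkI_ext c.
by move=> i im; rewrite -(@iter_derivI_ext i f)//; exact: H.
Qed.

Lemma flat_le k m h t : (k <= m)%N -> flat I m h t -> flat I k h t.
Proof.
move=> km [c H]; split; first exact: CkI_le c.
by move=> i ik; apply: H; exact: leq_trans km.
Qed.

Lemma flat_deriv m h h' t : I t -> (forall s, I s -> is_dI I h s (h' s)) ->
  h t = 0 -> flat I m h' t -> flat I m.+1 h t.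
Proof.
move=> It H h0 F; apply/flatS; split=> //; first by move=> s Is; exact: is_dI_cvg (H s Is).
by apply: flat_ext F => // s Is; rewrite (is_dI_derivI _ Is (H s Is)).
Qed.

Lemma flat_dI m h t s : flat I m.+1 h t -> I s -> is_dI I h s (derivI I h s).
Proof. by move=> /flatS[_ d _] Is; exact: derivIP (d s Is). Qed.

Lemma flat0 m t : I t -> flat I m (fun=> 0) t.
Proof.
move=> It; elim: m => [|m IH]; first by split=> //; exact: CkI_cst.
by apply: (flat_deriv It _ _ IH) => // s Is; exact: is_dI_cst.
Qed.

Lemma flatD m f g t : I t -> flat I m f t -> flat I m g t -> flat I m (fun s => f s + g s) t.
Proof.
move=> It; elim: m f g => [|m IH] f g F G.
  by split=> //; exact: CkID F.1 G.1.
apply: (flat_deriv It (h' := fun s => derivI I f s + derivI I g s)).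
- by move=> s Is; exact: is_dID (flat_dI F Is) (flat_dI G Is).
- by case/flatS : F => -> _ _; case/flatS : G => -> _ _; rewrite addr0.
- by apply: IH; [case/flatS : F|case/flatS : G].
Qed.

Lemma flatM m f g t : I t -> CkI I m f -> flat I m g t -> flat I m (fun s => f s * g s) t.
Proof.
move=> It; elim: m f g => [|m IH] f g F G.
  by split=> //; exact: CkIM F G.1.
have /flatS[g0 dg G'] := G.
apply: (flat_deriv It (h' := fun s => derivI I f s * g s + f s * derivI I g s)).
- by move=> s Is; exact: is_dIM (CkI_dI F Is) (flat_dI G Is).
- by rewrite g0 mulr0.
- apply: flatD => //; apply: IH => //; first exact: F.2.
    exact: flat_le G.
  exact: CkIW F.
Qed.

Lemma flat_sum m (J : Type) (r : seq J) (F : J -> R -> R) t : I t ->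
  (forall j, flat I m (F j) t) -> flat I m (fun s => \sum_(j <- r) F j s) t.
Proof.
move=> It H; elim: r => [|j r IH].
  by apply: flat_ext (flat0 m It) => // s _; rewrite big_nil.
by apply: flat_ext (flatD It (H j) IH) => // s _; rewrite big_cons.
Qed.

Lemma is_dI_horner (p : {poly R}) t : is_dI I (horner p) t (p^`()).[t].
Proof.
elim/poly_ind: p => [|p c IH].
  rewrite deriv0 horner0; have -> : horner (0 : {poly R}) = fun=> 0.
    by apply/funext => s; rewrite horner0.
  exact: is_dI_cst.
have -> : horner (p * 'X + c%:P) = fun s => p.[s] * s + c.
  by apply/funext => s; rewrite hornerMXaddC.
rewrite -[X in is_dI _ _ _ X]addr0.
apply: is_dID; last exact: is_dI_cst.
apply: is_dI_eq; first exact: (@is_dIM _ _ _ _ id _ _ _ IH (is_dI_id _ _ _)).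
by rewrite derivMXaddC hornerD hornerMX mulr1 addrC.
Qed.

Lemma CkI_horner k (p : {poly R}) : CkI I k (horner p).
Proof.
elim: k p => [|k IH] p; last by apply: CkIS (IH _) => // t _; exact: is_dI_horner.
by apply: diffI_continuous => t It; apply/cvg_ex; exists (p^`()).[t]; exact: is_dI_horner.
Qed.

Lemma poly_primitive (p : {poly R}) : exists q : {poly R}, q^`() = p.
Proof.
exists (\poly_(i < (size p).+1) (p`_i.-1 / i%:R)).
apply/polyP => i; rewrite coef_deriv coef_poly ltnS; case: ltnP => [ip|pi] /=.
  by rewrite -[LHS]mulr_natr divfK// pnatr_eq0.
by rewrite mul0rn nth_default.
Qed.

(** Integrate the polynomial found for the derivative and adjust its constant term at [t]. *)
Lemma taylor m h t : I t -> CkI I m h ->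
  exists p : {poly R}, flat I m (fun s => h s - p.[s]) t.
Proof.
move=> It; elim: m h => [|m IH] h ch.
  exists 0; split=> //; apply: CkI_ext ch => // s _; by rewrite horner0 subr0.
have [p1 F] := IH _ ch.2; have [q qE] := poly_primitive p1.
exists (q + (h t - q.[t])%:P).
apply: (flat_deriv It _ _ F) => [s Is|]; last by rewrite hornerD hornerC; ring.
apply: is_dID; first exact: CkI_dI ch Is.
have -> : (fun s => - (q + (h t - q.[t])%:P).[s]) = horner (- (q + (h t - q.[t])%:P)).
  by apply/funext => u; rewrite hornerN.
apply: is_dI_eq; first exact: is_dI_horner.
by rewrite derivN derivD derivC addr0 qE hornerN.
Qed.

Lemma poly_jet m (c : nat -> R) t : I t ->
  exists p : {poly R}, forall i, (i < m)%N -> iter i (derivI I) (horner p) t = c i.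
Proof.
move=> It; elim: m c => [|m IH] c; first by exists 0.
have [p1 H] := IH (c \o S); have [q qE] := poly_primitive p1.
exists (q + (c 0%N - q.[t])%:P) => -[_|i].
  by rewrite /= hornerD hornerC; ring.
rewrite ltnS => im; rewrite iterSr -[RHS]H//; apply: iter_derivI_ext => // s Is.
by rewrite (is_dI_derivI _ Is (is_dI_horner (p := _) (t := _)))// derivD derivC addr0 qE.
Qed.

Lemma iter_derivI_sum (J : Type) (r : seq J) (F : J -> R -> R) i t : I t ->
  (forall j, CkI I i (F j)) ->
  iter i (derivI I) (fun s => \sum_(j <- r) F j s) t = \sum_(j <- r) iter i (derivI I) (F j) t.
Proof.
elim: i F t => [//|i IH] F t It cF; rewrite iterSr.
have D s : I s -> derivI I (fun s => \sum_(j <- r) F j s) s = \sum_(j <- r) derivI I (F j) s.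
  by move=> Is; apply: is_dI_derivI => //; apply: is_dI_sum => j _; exact: CkI_dI (cF j) Is.
rewrite (iter_derivI_ext _ D)// IH//.
  by apply: eq_bigr => j _; rewrite iterSr.
by move=> j; exact: (cF j).2.
Qed.

Lemma iter_derivI_lin (c : R) (f g : R -> R) i t : I t -> CkI I i f -> CkI I i g ->
  iter i (derivI I) (fun s => f s + c * g s) t = iter i (derivI I) f t + c * iter i (derivI I) g t.
Proof.
elim: i f g t => [//|i IH] f g t It cf cg; rewrite !iterSr.
have D s : I s -> derivI I (fun s => f s + c * g s) s = derivI I f s + c * derivI I g s.
  move=> Is; apply: is_dI_derivI => //; apply: is_dID; first exact: CkI_dI cf Is.
  apply: is_dI_eq; first by apply: is_dIM (CkI_dI cg Is); exact: is_dI_cst.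
  by rewrite mul0r add0r.
by rewrite (iter_derivI_ext _ D)// IH//; [exact: cf.2|exact: cg.2].
Qed.

(** Pascal's rule, the inductive step of the Leibniz formula; [F] and [G] stand for the sequences of
    derivatives. *)
Lemma leibniz_sum (F G : nat -> R) i :
  \sum_(j < i.+1) 'C(i, j)%:R * (F (i - j).+1 * G j)
  + \sum_(j < i.+1) 'C(i, j)%:R * (F (i - j)%N * G j.+1)
  = \sum_(j < i.+2) 'C(i.+1, j)%:R * (F (i.+1 - j)%N * G j).
Proof.
rewrite [RHS]big_ord_recl [X in X + _]big_ord_recl /= !bin0 !subn0 -addrA; congr (_ + _).
rewrite [in RHS](eq_bigr (fun j : 'I_i.+1 => 'C(i, j.+1)%:R * (F (i - j)%N * G j.+1)
   + 'C(i, j)%:R * (F (i - j)%N * G j.+1))); last first.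
  by move=> j _; rewrite /bump /= add1n binS natrD mulrDl subSS.
rewrite big_split /=; congr (_ + _).
rewrite [RHS]big_ord_recr /= bin_small// mul0r addr0.
by apply: eq_bigr => j _; rewrite /bump /= add1n -subSn// subSS.
Qed.

Lemma iter_derivI_mul i (f g : R -> R) t : I t -> CkI I i f -> CkI I i g ->
  iter i (derivI I) (fun s => f s * g s) t =
  \sum_(j < i.+1) 'C(i, j)%:R * (iter (i - j) (derivI I) f t * iter j (derivI I) g t).
Proof.
move=> It; elim: i f g => [|i IH] f g cf cg.
  by rewrite big_ord1 /= bin0 mul1r.
rewrite iterSr.
(* The factor 1 brings the product rule into the shape f + c g required by [iter_derivI_lin]. *)
have D s : I s -> derivI I (fun s => f s * g s) s = derivI I f s * g s + 1 * (f s * derivI I g s).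
  move=> Is; apply: is_dI_derivI => //; rewrite mul1r.
  exact: is_dIM (CkI_dI cf Is) (CkI_dI cg Is).
rewrite (iter_derivI_ext _ D)// iter_derivI_lin//; last 2 first.
- by apply: CkIM => //; [exact: cf.2|exact: CkIW].
- by apply: CkIM => //; [exact: CkIW|exact: cg.2].
rewrite mul1r IH ?IH//; [|exact: CkIW|exact: cg.2|exact: cf.2|exact: CkIW].
rewrite -(leibniz_sum (fun k => iter k (derivI I) f t) (fun k => iter k (derivI I) g t)).
by congr (_ + _); apply: eq_bigr => j _; rewrite ?iterSr.
Qed.

Lemma derivnMxE k m n (X : R -> 'M[R]_(m, n)) t i j :
  derivnMx I k X t i j = iter k (derivI I) (fun s => X s i j) t.
Proof.
rewrite /derivnMx; elim: k t => // k IH t; rewrite !iterS mxE.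
by congr derivI; apply/funext => s; exact: IH.
Qed.

Lemma derivnMxS k m n (X : R -> 'M[R]_(m, n)) : derivnMx I k.+1 X = derivnMx I k (derivMx I X).
Proof. by rewrite /derivnMx iterSr. Qed.

Lemma derivnMx_ext k m n (X Y : R -> 'M[R]_(m, n)) t :
  (forall s, I s -> X s = Y s) -> I t -> derivnMx I k X t = derivnMx I k Y t.
Proof.
by move=> XY It; apply/matrixP => i j; rewrite !derivnMxE; apply: iter_derivI_ext => // s Is; rewrite XY.
Qed.

Lemma derivnMx_lin k (c : R) m n (X Y : R -> 'M[R]_(m, n)) t : I t -> CkMx I k X -> CkMx I k Y ->
  derivnMx I k (fun s => X s + c *: Y s) t = derivnMx I k X t + c *: derivnMx I k Y t.
Proof.
move=> It cX cY; apply/matrixP => i j; rewrite !mxE !derivnMxE -iter_derivI_lin//.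
by apply: iter_derivI_ext => // s _; rewrite !mxE.
Qed.

Lemma derivnMxM k m n p (X : R -> 'M[R]_(m, n)) (Y : R -> 'M[R]_(n, p)) t :
  I t -> CkMx I k X -> CkMx I k Y ->
  derivnMx I k (fun s => X s *m Y s) t =
  \sum_(j < k.+1) 'C(k, j)%:R *: (derivnMx I (k - j) X t *m derivnMx I j Y t).
Proof.
move=> It cX cY; apply/matrixP => i j; rewrite derivnMxE summxE.
rewrite (@iter_derivI_ext _ _ (fun s => \sum_l X s i l * Y s l j))//; last first.
  by move=> s _; rewrite mxE.
rewrite iter_derivI_sum//; last by move=> l; apply: CkIM.
under [RHS]eq_bigr do rewrite !mxE mulr_sumr.
rewrite exchange_big; apply: eq_bigr => l _; rewrite iter_derivI_mul//.
by apply: eq_bigr => l' _; rewrite !derivnMxE.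
Qed.

Lemma flatMxP k m n (X : R -> 'M[R]_(m, n)) t :
  flatMx I k X t <-> CkMx I k X /\ forall i, (i < k)%N -> derivnMx I i X t = 0.
Proof.
split=> [H|[H1 H2] i j].
  split=> [i j|l lk]; first exact: (H i j).1.
  by apply/matrixP => i j; rewrite derivnMxE mxE; apply: (H i j).2.
by split; [exact: H1|move=> l lk; rewrite -derivnMxE H2// mxE].
Qed.

Lemma flatMx_le l k m n (X : R -> 'M[R]_(m, n)) t :
  (l <= k)%N -> flatMx I k X t -> flatMx I l X t.
Proof. by move=> lk H i j; exact: flat_le (H i j). Qed.

Lemma flatMx_ext k m n (X Y : R -> 'M[R]_(m, n)) t :
  (forall s, I s -> X s = Y s) -> I t -> flatMx I k X t -> flatMx I k Y t.
Proof. by move=> XY It H i j; apply: flat_ext (H i j) => // s Is; rewrite XY. Qed.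

Lemma flatMxD k m n (X Y : R -> 'M[R]_(m, n)) t : I t ->
  flatMx I k X t -> flatMx I k Y t -> flatMx I k (fun s => X s + Y s) t.
Proof. by move=> It hX hY i j; apply: flat_ext (flatD It (hX i j) (hY i j)) => // s _; rewrite mxE. Qed.

Lemma flatMxM k m n p (X : R -> 'M[R]_(m, n)) (Y : R -> 'M[R]_(n, p)) t : I t ->
  CkMx I k X -> flatMx I k Y t -> flatMx I k (fun s => X s *m Y s) t.
Proof.
move=> It hX hY i j.
apply: (flat_ext (f := fun s => \sum_l X s i l * Y s l j)) => //.
  by move=> s _; rewrite mxE.
by apply: flat_sum => // l; exact: flatM.
Qed.

Lemma flatMxN k m n (X : R -> 'M[R]_(m, n)) t : I t ->
  flatMx I k X t -> flatMx I k (fun s => - X s) t.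
Proof.
move=> It hX; apply: flatMx_ext (flatMxM It (CkMx_cst ab k (- 1%:M)) hX) => // s _.
by rewrite mulNmx mul1mx.
Qed.

Lemma flatMxB k m n (X Y : R -> 'M[R]_(m, n)) t : I t ->
  flatMx I k X t -> flatMx I k Y t -> flatMx I k (fun s => X s - Y s) t.
Proof. by move=> It hX hY; exact: flatMxD It hX (flatMxN It hY). Qed.

Lemma flatMx_deriv k m n (X : R -> 'M[R]_(m, n)) t : I t ->
  flatMx I k.+1 X t -> flatMx I k (derivMx I X) t.
Proof.
move=> It H i j; have /flatS[_ _] := H i j.
by apply: flat_ext => // s _; rewrite mxE.
Qed.

Lemma flatMx_val k m n (X : R -> 'M[R]_(m, n)) t : flatMx I k.+1 X t -> X t = 0.
Proof. by move=> H; apply/matrixP => i j; rewrite mxE; apply: (H i j).2 0%N _. Qed.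

Lemma poly_funM m n p (C : 'M[R]_(m, n)) (Y : R -> 'M[R]_(n, p)) :
  poly_fun Y -> poly_fun (fun s => C *m Y s).
Proof.
move=> hY i j; have [q hq] := choice (fun l => hY l j).
exists (\sum_l (C i l)%:P * q l) => s; rewrite mxE horner_sum.
by apply: eq_bigr => l _; rewrite hornerCM hq.
Qed.

Lemma poly_fun_Ck k m n (X : R -> 'M[R]_(m, n)) : poly_fun X -> CkMx I k X.
Proof.
move=> hX i j; have [p hp] := hX i j.
by apply: CkI_ext (CkI_horner k p) => // s _.
Qed.

Lemma taylorMx k m n (X : R -> 'M[R]_(m, n)) t : I t -> CkMx I k X ->
  exists2 Y, poly_fun Y & flatMx I k (fun s => X s - Y s) t.
Proof.
move=> It cX.
have [p hp] := choice (fun ij : 'I_m * 'I_n => taylor It (cX ij.1 ij.2)).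
exists (fun s => \matrix_(i, j) (p (i, j)).[s]).
  by move=> i j; exists (p (i, j)) => s; rewrite mxE.
by move=> i j; apply: flat_ext (hp (i, j)) => // s _; rewrite !mxE.
Qed.

Lemma poly_jetMx k m n (c : nat -> 'M[R]_(m, n)) t : I t ->
  exists2 Y, poly_fun Y & forall i, (i < k)%N -> derivnMx I i Y t = c i.
Proof.
move=> It.
have [p hp] := choice (fun ij : 'I_m * 'I_n => poly_jet k (fun l => c l ij.1 ij.2) It).
exists (fun s => \matrix_(i, j) (p (i, j)).[s]).
  by move=> i j; exists (p (i, j)) => s; rewrite mxE.
move=> l lk; apply/matrixP => i j; rewrite derivnMxE -(hp (i, j))//.
by apply: iter_derivI_ext => // s _; rewrite mxE.
Qed.

End Flat.


(** * Linear ordinary differential equations *)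

Lemma exists_small_geometric (R : realType) (K e : R) : 0 < e -> exists k, K / 2 ^+ k < e.
Proof.
move=> e0; have := upper_nthrootP (leqnn (Num.bound (K / e))) => H.
exists (Num.bound (K / e)); rewrite ltr_pdivrMr ?exprn_gt0// mulrC.
by rewrite -ltr_pdivrMr.
Qed.

(** The tail of the series K / 2^k sums to 2 K / 2^k, so the intervals of that radius around [u k]
    are nested; the supremum of their left ends lies in all of them. *)
Lemma cvg_geometric_increments (R : realType) (u : nat -> R) (K : R) :
  (forall k, `|u k.+1 - u k| <= K / 2 ^+ k) ->
  exists l, forall k, `|u k - l| <= 2 * K / 2 ^+ k.
Proof.
move=> H.
have K0 : 0 <= K by have := H 0%N; rewrite expr0 divr1; exact: le_trans.
pose v k := u k + 2 * K / 2 ^+ k; pose w k := u k - 2 * K / 2 ^+ k.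
have p2 k : 2 * K / 2 ^+ k = K / 2 ^+ k + 2 * K / 2 ^+ k.+1.
  by rewrite exprS; field; rewrite expf_neq0.
have wS k : w k <= w k.+1.
  have := H k; rewrite ler_norml /w (p2 k) => /andP[h _]; move: h; set x := K / _; set y := _ / _; lra.
have vS k : v k.+1 <= v k.
  have := H k; rewrite ler_norml /v (p2 k) => /andP[_ h]; move: h; set x := K / _; set y := _ / _; lra.
have wm i j : (i <= j)%N -> w i <= w j.
  by move=> /subnK <-; elim: (j - i)%N => // l IH; rewrite addSn; exact: le_trans (wS _).
have vm i j : (i <= j)%N -> v j <= v i.
  by move=> /subnK <-; elim: (j - i)%N => // l IH; rewrite addSn; exact: le_trans (vS _) IH.
have wv i j : w i <= v j.
  apply: (le_trans (wm _ _ (leq_maxl i j))); apply: le_trans (vm _ _ (leq_maxr i j)).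
  have : 0 <= 2 * K / 2 ^+ maxn i j by rewrite divr_ge0 ?exprn_ge0// mulr_ge0.
  by rewrite /w /v; set y := _ / _; lra.
exists (sup (range w)) => k.
have hs : has_sup (range w).
  by split; [exists (w 0%N), 0%N|exists (v 0%N) => _ [i _ <-]].
have s1 : w k <= sup (range w) by apply: sup_upper_bound => //; exists k.
have s2 : sup (range w) <= v k by apply: ge_sup; [exists (w 0%N), 0%N|move=> _ [i _ <-]].
by move: s1 s2; rewrite ler_norml /w /v; set y := _ / _ => s1 s2; apply/andP; split; lra.
Qed.

Section LinearODE.
Variables (R : realType) (a b : R).
Hypothesis ab : a < b.
Local Notation I := `[a, b]%classic.

Let Ia : I a. Proof. by rewrite /= in_itv /= lexx ltW. Qed.

(** Both h - f and h + f have nonnegative derivative and start at a nonnegative value. *)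
Lemma norm_le_is_dI (f f' h h' : R -> R) :
  (forall t, I t -> is_dI I f t (f' t)) -> (forall t, I t -> is_dI I h t (h' t)) ->
  (forall t, I t -> `|f' t| <= h' t) -> f a = 0 -> 0 <= h a ->
  forall t, I t -> `|f t| <= h t.
Proof.
move=> Hf Hh fh fa ha t It.
have at_ : a <= t by move: It; rewrite /= in_itv /= => /andP[].
have D1 s : I s -> is_dI I (fun s => h s + f s) s (h' s + f' s).
  by move=> Is; exact: is_dID (Hh s Is) (Hf s Is).
have D2 s : I s -> is_dI I (fun s => h s + -1 * f s) s (h' s - f' s).
  move=> Is; apply: is_dI_eq.
    by apply: is_dID (Hh s Is) _; apply: is_dIM (Hf s Is); exact: is_dI_cst.
  by rewrite mul0r add0r mulN1r.
have := le_is_dI D1 _ Ia It at_; have := le_is_dI D2 _ Ia It at_.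
rewrite fa mulr0 !addr0 mulN1r ler_norml => h1 h2.
have {}h1 : h a <= h t - f t.
  by apply: h1 => s Is; have := fh s Is; rewrite ler_norml => /andP[]; lra.
have {}h2 : h a <= h t + f t.
  by apply: h2 => s Is; have := fh s Is; rewrite ler_norml => /andP[]; lra.
by apply/andP; split; lra.
Qed.

Lemma CkI0_bounded (f : R -> R) : CkI I 0 f -> exists c : R, forall t, I t -> `|f t| <= c.
Proof.
move=> cf.
have [x _ Hx] := EVT_max (ltW ab) cf; have [y _ Hy] := EVT_min (ltW ab) cf.
exists (`|f x| + `|f y|) => t It; have := Hx t It; have := Hy t It.
have := ler_norm (f x); have := ler_norm (- f y); rewrite normrN.
have := normr_ge0 (f x); have := normr_ge0 (f y).
by move=> *; rewrite ler_norml; apply/andP; split; lra.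
Qed.

Lemma CkMx0_bounded m n (X : R -> 'M[R]_(m, n)) : CkMx I 0 X ->
  exists2 c : R, 0 <= c & forall t i j, I t -> `|X t i j| <= c.
Proof.
move=> cX.
have [c hc] := choice (fun ij : 'I_m * 'I_n => CkI0_bounded (cX ij.1 ij.2)).
exists (\sum_ij `|c ij|); first by apply: sumr_ge0.
move=> t i j It; apply: (le_trans (hc (i, j) t It)); apply: (le_trans (ler_norm _)).
by rewrite (bigD1 (i, j))//= lerDl sumr_ge0.
Qed.

Lemma mulmx_entry_le m n p (X : 'M[R]_(m, n)) (Y : 'M[R]_(n, p)) (x y : R) :
  (forall i j, `|X i j| <= x) -> (forall i j, `|Y i j| <= y) ->
  forall i j, `|(X *m Y) i j| <= n%:R * x * y.
Proof.
move=> hx hy i j; rewrite mxE; apply: (le_trans (ler_norm_sum _ _ _)).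
apply: (le_trans (y := \sum_(k < n) x * y)).
  by apply: ler_sum => k _; rewrite normrM; apply: ler_pM.
by rewrite sumr_const card_ord -[leLHS]mulr_natl mulrA.
Qed.

Lemma uniform_limit_CkI0 (u : nat -> R -> R) (f : R -> R) (K : R) :
  (forall k, CkI I 0 (u k)) -> (forall k t, I t -> `|u k t - f t| <= K / 2 ^+ k) -> CkI I 0 f.
Proof.
move=> cu uf; apply/continuous_itvP => t It P [e /= e0 He].
have [k hk] := exists_small_geometric K (divr_gt0 e0 (ltr0n _ 3)).
have /continuous_itvP /(_ t It) cuk := cu k.
have b0 : nbhs (u k t) (ball (u k t) (e / 3)) by apply: nbhsx_ballx; rewrite divr_gt0.
have : nbhs t [set s | I s -> ball (u k t) (e / 3) (u k s)] by exact: cuk b0.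
suff : forall s, (I s -> ball (u k t) (e / 3) (u k s)) -> (I s -> P (f s)).
  by move=> W Q; have : nbhs t [set s | I s -> P (f s)] by apply: filterS Q.
move=> s H Is; apply: He => /=.
have h1 := uf k t It; have h2 := uf k s Is; have h3 : `|u k t - u k s| < e / 3 by exact: H.
have h4 : `|f t - f s| <= `|u k t - f t| + `|u k t - u k s| + `|u k s - f s|.
  have -> : f t - f s = - (u k t - f t) + (u k t - u k s) + (u k s - f s) by ring.
  apply: (le_trans (ler_normD _ _)); rewrite lerD2r.
  by apply: (le_trans (ler_normD _ _)); rewrite normrN.
by apply: (le_lt_trans h4); lra.
Qed.

Lemma is_dI_expR (c l t : R) : is_dI I (fun s => c * expR (l * (s - a))) t (l * (c * expR (l * (t - a)))).
Proof.
have D : is_derive t 1 (fun s => c * expR (l * (s - a))) (l * (c * expR (l * (t - a)))).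
  by apply: is_derive_eq; rewrite /GRing.scale /=; ring.
have := @diff_quot_derivable _ (fun s => c * expR (l * (s - a))) t.
case: D => d1 d2 /(_ d1); rewrite d2; apply: cvg_trans.
move=> P Pl.
have H : nbhs t [set s | s != t -> P (diff_quot (fun s => c * expR (l * (s - a))) t s)] by [].
suff : nbhs t [set s | s != t -> I s -> P (diff_quot (fun s => c * expR (l * (s - a))) t s)] by [].
by apply: filterS H => s W st _; exact: W.
Qed.

(** Continuity is assumed inside the existential so that [choice] yields one primitive operator on
    all matrix functions, arbitrary on the discontinuous ones. *)
Lemma primitiveMx_exists m n (G : R -> 'M[R]_(m, n)) :
  exists P : R -> 'M[R]_(m, n),
    CkMx I 0 G -> P a = 0 /\ forall t, I t -> is_dMx I P t (G t).
Proof.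
have [cG|] := pselect (CkMx I 0 G); last by exists (fun=> 0).
have H (ij : 'I_m * 'I_n) : exists P : R -> R,
    P a = 0 /\ forall t, I t -> is_dI I P t (G t ij.1 ij.2).
  by have [P p1 p2] := primitive_exists ab (cG ij.1 ij.2); exists P.
have [F hF] := choice H.
exists (fun t => \matrix_(i, j) F (i, j) t) => _; split.
  by apply/matrixP => i j; rewrite !mxE (hF (i, j)).1.
move=> t It i j; have -> : (fun s => (\matrix_(i, j) F (i, j) s) i j) = F (i, j).
  by apply/funext => s; rewrite mxE.
exact: (hF (i, j)).2.
Qed.

Variables (n m : nat) (B : R -> 'M[R]_n) (C : 'M[R]_(n, m)).
Hypothesis cB : CkMx I 0 B.

(* Picard iteration; the increments are bounded by c 2^-k e^(l (t - a)), where the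
   weight with l twice a bound for B provides the factor 1/2. *)
Lemma linear_ode_exists :
  exists2 X : R -> 'M[R]_(n, m), X a = C & forall t, I t -> is_dMx I X t (B t *m X t).
Proof.
have [prim hprim] := choice (fun G : R -> 'M[R]_(n, m) => primitiveMx_exists G).
pose X := fix X k := if k is k'.+1 then fun t => C + prim (fun s => B s *m X k' s) t else fun=> C.
have cX k : CkMx I 0 (X k).
  elim: k => [|k IH]; first exact: CkMx_cst.
  have cBX : CkMx I 0 (fun s => B s *m X k s) by exact: CkMxM.
  apply: CkMxD => //; first exact: CkMx_cst.
  have [_ h] := hprim _ cBX.
  by apply: (CkMx_le (leq0n 1)); apply: (CkMxS ab) cBX.
have cBX k : CkMx I 0 (fun s => B s *m X k s) by exact: CkMxM.
have dX k t : I t -> is_dMx I (X k.+1) t (B t *m X k t).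
  move=> It; rewrite -[B t *m _]add0r; apply: is_dMxD; first exact: is_dMx_cst.
  by have [_] := hprim _ (cBX k); apply.
have Xa k : X k a = C by case: k => //= k; rewrite (hprim _ (cBX k)).1 addr0.
have [M M0 hM] := CkMx0_bounded cB.
have [c c0 hc] := CkMx0_bounded (CkMxB ab (cX 1%N) (cX 0%N)).
pose l := 2 * (n%:R * M).
have l0 : 0 <= l by rewrite /l !mulr_ge0.
pose e t := expR (l * (t - a)).
have hD k t i j : I t -> `|X k.+1 t i j - X k t i j| <= c / 2 ^+ k * e t.
  elim: k t i j => [|k IH] t i j It.
    have := hc t i j It; rewrite !mxE => h; apply: (le_trans h).
    rewrite expr0 divr1 ler_peMr// -expR0 ler_expR mulr_ge0// subr_ge0.
    by move: It; rewrite /= in_itv /= => /andP[].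
  have Df s : I s -> is_dI I (fun s => X k.+2 s i j - X k.+1 s i j) s ((B s *m (X k.+1 s - X k s)) i j).
    move=> Is; rewrite mulmxBr; have D := is_dMxB (dX k.+1 s Is) (dX k s Is); have := D i j.
    by congr is_dI; apply/funext => u; rewrite !mxE.
  have Dh s : I s -> is_dI I (fun s => c / 2 ^+ k.+1 * e s) s (l * (c / 2 ^+ k.+1 * e s)).
    by move=> Is; exact: is_dI_expR.
  apply: (norm_le_is_dI Df Dh) It => [s Is||].
  - have -> : l * (c / 2 ^+ k.+1 * e s) = n%:R * M * (c / 2 ^+ k * e s).
      by rewrite /l exprS; field; rewrite expf_neq0.
    apply: mulmx_entry_le; first by move=> i' j'; exact: hM.
    by move=> i' j'; rewrite mxE [X in _ + X]mxE; exact: IH.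
  - by rewrite !Xa subrr.
  - by rewrite mulr_ge0 ?divr_ge0 ?exprn_ge0 ?expR_ge0.
pose K := c * e b.
have hK k t i j : I t -> `|X k.+1 t i j - X k t i j| <= K / 2 ^+ k.
  move=> It; apply: (le_trans (hD k t i j It)); rewrite /K mulrAC.
  rewrite ler_pM2r ?invr_gt0 ?exprn_gt0// ler_wpM2l// ler_expR ler_wpM2l// lerD2r.
  by move: It; rewrite /= in_itv /= => /andP[].
have [Y hY] : exists Y : R -> 'M[R]_(n, m), forall t, I t -> forall k i j,
    `|X k t i j - Y t i j| <= 2 * K / 2 ^+ k.
  suff H t : exists Yt : 'M[R]_(n, m), I t -> forall k i j, `|X k t i j - Yt i j| <= 2 * K / 2 ^+ k.
    by have [Y hY] := choice H; exists Y.
  have [It|] := pselect (I t); last by exists 0.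
  have [L hL] := choice (fun ij : 'I_n * 'I_m =>
    cvg_geometric_increments (u := fun k => X k t ij.1 ij.2) (fun k => hK k t ij.1 ij.2 It)).
  by exists (\matrix_(i, j) L (i, j)) => _ k i j; rewrite mxE; exact: (hL (i, j)).
have cY : CkMx I 0 Y.
  move=> i j; apply: (@uniform_limit_CkI0 (fun k t => X k t i j) _ (2 * K)).
    by move=> k; exact: cX.
  by move=> k t It; exact: hY.
have cBY : CkMx I 0 (fun s => B s *m Y s) by exact: CkMxM.
have [Za dZ] := hprim _ cBY.
(* The limit [Y] is so far only continuous. Its image under the Picard map is differentiable by
   construction, and the two are then shown to coincide. *)
exists (fun t => C + prim (fun s => B s *m Y s) t); first by rewrite Za addr0.
set Z := fun t => C + _.
have {}dZ t : I t -> is_dMx I Z t (B t *m Y t).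
  by move=> It; rewrite -[B t *m _]add0r; apply: is_dMxD; [exact: is_dMx_cst|exact: dZ].
suff YZ t : I t -> Y t = Z t by move=> t It; have := dZ t It; rewrite YZ.
move=> It; apply/matrixP => i j; apply/eqP; rewrite -subr_eq0 -normr_le0; apply/ler_addgt0Pl => d d0.
(* The distance from X (k+1) to Y is at most K / 2^k, and that to Z at most n M (2 K) (b - a) / 2^k
   by integrating B (X k - Y). [K2] is twice the sum of the two constants. *)
pose K2 := 2 * K + n%:R * M * (2 * K) * (b - a) * 2.
have [k hk] := exists_small_geometric K2 d0.
rewrite addr0; apply: le_trans (ltW hk).
have h1 := hY t It k.+1 i j.
have h2 : `|X k.+1 t i j - Z t i j| <= n%:R * M * (2 * K / 2 ^+ k) * (t - a).
  have Df s : I s -> is_dI I (fun s => X k.+1 s i j - Z s i j) s ((B s *m (X k s - Y s)) i j).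
    move=> Is; rewrite mulmxBr; have D := is_dMxB (dX k s Is) (dZ s Is); have := D i j.
    by congr is_dI; apply/funext => u; rewrite !mxE.
  have Dh s : I s -> is_dI I (fun s => n%:R * M * (2 * K / 2 ^+ k) * (s - a)) s (n%:R * M * (2 * K / 2 ^+ k)).
    move=> Is; apply: is_dI_eq.
      apply: is_dIM; first exact: is_dI_cst.
      by apply: is_dID; [exact: is_dI_id|exact: is_dI_cst].
    by rewrite mul0r add0r addr0 mulr1.
  apply: (norm_le_is_dI Df Dh) It => [s Is||].
  - apply: mulmx_entry_le; first by move=> i' j'; exact: hM.
    by move=> i' j'; rewrite !mxE; exact: hY.
  - by rewrite Xa /Z Za addr0 subrr.
  - by rewrite subrr mulr0.
have h3 : `|Y t i j - Z t i j| <= `|X k.+1 t i j - Y t i j| + `|X k.+1 t i j - Z t i j|.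
  have -> : Y t i j - Z t i j = - (X k.+1 t i j - Y t i j) + (X k.+1 t i j - Z t i j) by ring.
  by apply: (le_trans (ler_normD _ _)); rewrite normrN.
apply: (le_trans h3); apply: (le_trans (lerD h1 h2)).
have K0 : 0 <= K by rewrite mulr_ge0 ?expR_ge0.
have /andP[at_ tb] : (a <= t) && (t <= b) by move: It; rewrite /= in_itv.
have h4 : n%:R * M * (2 * K / 2 ^+ k) * (t - a) <= n%:R * M * (2 * K / 2 ^+ k) * (b - a).
  apply: ler_wpM2l; last by rewrite lerD2r.
  apply: mulr_ge0; first exact: mulr_ge0.
  by apply: divr_ge0; [exact: mulr_ge0|exact: exprn_ge0].
apply: (le_trans (lerD (lexx _) h4)).
have -> : 2 * K / 2 ^+ k.+1 = K / 2 ^+ k by rewrite exprS; field; rewrite expf_neq0.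
rewrite /K2 [leRHS]mulrDl; apply: lerD.
  by rewrite ler_wpM2r ?invr_ge0 ?exprn_ge0//; lra.
have -> : n%:R * M * (2 * K / 2 ^+ k) * (b - a) = n%:R * M * (2 * K) * (b - a) / 2 ^+ k by ring.
rewrite ler_wpM2r ?invr_ge0 ?exprn_ge0// ler_peMr//; last by lra.
apply: mulr_ge0; last by rewrite subr_ge0 ltW.
by apply: mulr_ge0; exact: mulr_ge0.
Qed.

(** Bootstrapping: if X is C^j with j <= k, then X' = B X is C^j, so X is C^(j+1). *)
Lemma linear_ode_CkMx k (X : R -> 'M[R]_(n, m)) :
  (forall t, I t -> is_dMx I X t (B t *m X t)) -> CkMx I k B -> CkMx I k.+1 X.
Proof.
move=> dX; have c0 : CkMx I 0 X.
  by move=> i j; apply: diffI_continuous => // t It; exact: is_dI_cvg (dX t It i j).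
elim: k => [|k IH] cBk; first by apply: (CkMxS ab) dX _; exact: CkMxM.
by apply: (CkMxS ab) dX _; apply: CkMxM => //; apply: IH; apply: CkMx_le cBk.
Qed.

End LinearODE.


(** * Smooth complements of constant rank *)

Section MatrixComplements.
Variable F : fieldType.

(** [D] is completed by rows [C] to an invertible matrix whose inverse has the column blocks [H] and
    [G]; the identities are the two products. *)
Lemma row_free_complement q r n (D : 'M[F]_(q, n)) : (q + r)%N = n -> row_free D ->
  exists (C : 'M[F]_(r, n)) (G : 'M[F]_(n, r)) (H : 'M[F]_(n, q)),
  [/\ C *m G = 1%:M, C *m H = 0, D *m G = 0, D *m H = 1%:M & G *m C + H *m D = 1%:M].
Proof.
move=> e; case: n / e D => D fD.
have rC : \rank (D^C)%MS = r by rewrite mxrank_compl (eqP fD) addKn.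
have [C hC] : exists C : 'M[F]_(r, q + r), (C :=: D^C)%MS.
  by move: (row_base (D^C)%MS) (eq_row_base (D^C)%MS); rewrite rC => C ?; exists C.
have uS : col_mx D C \in unitmx.
  rewrite -row_full_unit -sub1mx -addsmxE.
  apply: (submx_trans (B := (D + D^C)%MS)); first by rewrite sub1mx addsmx_compl_full.
  by rewrite addsmxS // hC.
exists C, (rsubmx (invmx (col_mx D C))), (lsubmx (invmx (col_mx D C))).
have := mulmxV uS; rewrite -[X in _ *m X]hsubmxK mul_col_row scalar_mx_block.
move=> /eq_block_mx[e1 e2 e3 e4]; split=> //.
by rewrite -scalar_mx_block addrC -mul_row_col hsubmxK mulVmx.
Qed.

End MatrixComplements.

Lemma row_free_gram_unit (R : realFieldType) m n (X : 'M[R]_(m, n)) :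
  row_free X -> X *m X^T \in unitmx.
Proof.
move=> fX; rewrite -row_free_unit; apply: inj_row_free => v vX.
have: (v *m X) *m (v *m X)^T = 0 by rewrite trmx_mul mulmxA -[v *m X *m _]mulmxA vX mul0mx.
move=> /matrixP/(_ 0 0); rewrite mxE [RHS]mxE => /eqP; rewrite psumr_eq0; last first.
  by move=> i _; rewrite [_^T _ _]mxE -expr2 sqr_ge0.
move=> /allP H; apply/eqP; rewrite -(mulmx_free_eq0 _ fX); apply/eqP/rowP => i.
by have := H i (mem_index_enum _); rewrite [_^T _ _]mxE -expr2 sqrf_eq0 => /eqP ->; rewrite mxE.
Qed.

Section SmoothComplements.
Variables (R : realType) (a b : R).
Hypothesis ab : a < b.
Local Notation I := `[a, b]%classic.

Lemma CkMx_sub c d k m n (X : R -> 'M[R]_(m, n)) : c < d -> a <= c -> d <= b ->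
  CkMx I k X -> CkMx `[c, d]%classic k X.
Proof. by move=> cd ac db H i j; apply: CkI_sub (H i j). Qed.

Lemma is_dMx_sub c d m n (X : R -> 'M[R]_(m, n)) t X' : a <= c -> d <= b ->
  is_dMx I X t X' -> is_dMx `[c, d]%classic X t X'.
Proof. by move=> ac db H i j; apply: is_dI_sub (H i j) => s; exact: sub_itv_cc. Qed.

(** X^T (X X^T)^-1 is a right inverse, smooth wherever the Gram matrix is invertible, which is an
    open condition. *)
Lemma smooth_right_inverse k m n (X : R -> 'M[R]_(m, n)) t0 :
  CkMx I k X -> I t0 -> row_free (X t0) ->
  exists c d, [/\ c < d, a <= c, d <= b, `[c, d]%classic t0 &
    exists2 G, CkMx `[c, d]%classic k G & forall t, `[c, d]%classic t -> X t *m G t = 1%:M].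
Proof.
move=> cX It0 fX.
have cXX : CkMx I k (fun t => X t *m (X t)^T) by apply: CkMxM => //; exact: CkMxT.
have := CkMx_inv_open ab cXX It0 (row_free_gram_unit fX).
move=> /(exists_sub_itv ab It0)[c [d [cd ac db t0cd H]]].
exists c, d; split=> //; exists (fun t => (X t)^T *m invmx (X t *m (X t)^T)).
  apply: CkMxM => //; first by apply: CkMxT => //; exact: CkMx_sub cX.
  by apply: CkMx_inv => //; exact: CkMx_sub cXX.
by move=> t tcd; rewrite mulmxA mulmxV// H.
Qed.

Lemma exists_max_rank m n (X : R -> 'M[R]_(m, n)) :
  exists2 t0, I t0 & forall t, I t -> (\rank (X t) <= \rank (X t0))%N.
Proof.
pose P k := `[< exists2 t, I t & \rank (X t) = k >].
have P0 : exists k, P k.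
  by exists (\rank (X a)); apply/asboolP; exists a => //; rewrite /= in_itv /= lexx ltW.
have Pm k : P k -> (k <= m)%N by move=> /asboolP[t _ <-]; exact: rank_leq_row.
case: (ex_maxnP P0 Pm) => k /asboolP[t0 It0 <-] H; exists t0 => // t It.
by apply: H; apply/asboolP; exists t.
Qed.

(* [C] is constant because it is chosen at a single point where the rank of [E]
   is maximal; nearby the rows of [C *m E] still span the row space of [E]. *)
Lemma local_rank_factorization k n (E : R -> 'M[R]_n) : CkMx I k E ->
  exists c d r q, [/\ c < d, a <= c, d <= b, (q + r)%N = n &
    exists (C : 'M[R]_(r, n)) (H : 'M[R]_(n, q)) (P : R -> 'M[R]_(n, r))
      (B0 : R -> 'M[R]_(q, n)) (G : R -> 'M[R]_(n, r)),
    [/\ CkMx `[c, d]%classic k P, CkMx `[c, d]%classic k B0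
      & forall t, `[c, d]%classic t ->
        [/\ P t *m (C *m E t) = E t, P t *m C + H *m B0 t = 1%:M,
            C *m P t = 1%:M, B0 t *m H = 1%:M & B0 t *m E t = 0] /\
        C *m E t *m G t = 1%:M]].
Proof.
move=> cE; have [t0 It0 maxE] := exists_max_rank E.
pose q := \rank (kermx (E t0)); pose r := \rank (E t0).
have qr : (q + r)%N = n by rewrite /q /r mxrank_ker subnK// rank_leq_row.
have [C [G0 [H [h1 h2 h3 h4 h5]]]] := row_free_complement qr (row_base_free (kermx (E t0))).
pose D := row_base (kermx (E t0)).
have fCE : row_free (C *m E t0).
  apply: inj_row_free => v vCE.
  have : (v *m C <= D)%MS by rewrite eq_row_base; apply/sub_kermxP; rewrite -mulmxA.
  move=> /submxP[w vw]; rewrite -[v]mulmx1 -h1 mulmxA vw -mulmxA.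
  by rewrite [D *m G0]h3 mulmx0.
have cCE : CkMx I k (fun t => C *m E t) by apply: CkMxM => //; exact: CkMx_cst.
have [c [d [cd ac db t0cd [G cG hG]]]] := smooth_right_inverse cCE It0 fCE.
exists c, d, r, q; split=> //.
have cE' : CkMx `[c, d]%classic k E by exact: CkMx_sub cE.
have cP : CkMx `[c, d]%classic k (fun t => E t *m G t) by exact: CkMxM.
(* C E t has full row rank r, and r is the maximal rank of E; so both have the same row space, E = Y
   C E, and multiplying by G gives Y = E G. *)
have PE t : `[c, d]%classic t -> E t *m G t *m (C *m E t) = E t.
  move=> tcd; have It : I t by exact: sub_itv_cc tcd.
  have fr : row_free (C *m E t) by apply/row_freeP; exists (G t); exact: hG.
  have : (E t <= C *m E t)%MS.
    rewrite -(mxrank_leqif_sup (submxMl C (E t))); rewrite (eqP fr).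
    rewrite eqn_leq maxE// andbT; have := mxrankM_maxr C (E t).
    by rewrite (eqP fr).
  move=> /submxP[Y EY]; by rewrite {1}EY -[Y *m _ *m _]mulmxA hG// mulmx1 -EY.
(* The left kernel is D (1 - P C): it annihilates E because P C E = E, and C H = 0 preserves D H =
   1. *)
exists C, H, (fun t => E t *m G t), (fun t => D - D *m (E t *m G t) *m C), G; split=> //.
  apply: CkMxB => //; first exact: CkMx_cst.
  apply: CkMxM => //; last exact: CkMx_cst.
  by apply: CkMxM => //; exact: CkMx_cst.
move=> t tcd; have CP : C *m (E t *m G t) = 1%:M by rewrite mulmxA hG.
split; last exact: hG.
split=> //; first exact: PE.
- have -> : H *m (D - D *m (E t *m G t) *m C) =
      H *m D - (H *m D) *m (E t *m G t) *m C by rewrite mulmxBr !mulmxA.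
  have -> : H *m D = 1%:M - G0 *m C by rewrite -h5 addrAC subrr add0r.
  rewrite mulmxBl mul1mx -[G0 *m C *m _]mulmxA CP mulmx1 mulmxBl.
  have zE (V : zmodType) (x y z : V) : x + (z - y - (x - y)) = z.
    by rewrite opprB addrC -addrA subrK subrK.
  exact: zE.
- by rewrite mulmxBl -[_ *m C *m H]mulmxA h2 mulmx0 subr0 h4.
- by rewrite mulmxBl -!mulmxA [E t *m (G t *m _)]mulmxA PE// subrr.
Qed.

(** A complement [C] chosen at [t0] still completes B t nearby; the column blocks of the inverse are
    then a smooth kernel basis [K] and a smooth right inverse [L] of B. *)
Lemma local_smooth_complement k q r n (B : R -> 'M[R]_(q, n)) t0 : (q + r)%N = n ->
  CkMx I k B -> I t0 -> row_free (B t0) ->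
  exists c d, [/\ c < d, a <= c, d <= b &
    exists (C : 'M[R]_(r, n)) (K : R -> 'M[R]_(n, r)) (L : R -> 'M[R]_(n, q)),
    [/\ CkMx `[c, d]%classic k K, CkMx `[c, d]%classic k L
      & forall t, `[c, d]%classic t ->
        [/\ B t *m K t = 0, B t *m L t = 1%:M, C *m K t = 1%:M, C *m L t = 0
          & K t *m C + L t *m B t = 1%:M]]].
Proof.
move=> e; case: n / e B => B cB It0 fB.
have [C [G [H [h1 h2 h3 h4 h5]]]] := row_free_complement (erefl (q + r)%N) fB.
pose S t := col_mx (B t) C.
have cS : CkMx I k S by apply: CkMx_col => //; exact: CkMx_cst.
have uS : S t0 \in unitmx.
  have : row_mx H G *m S t0 = 1%:M by rewrite mul_row_col addrC.
  by case/mulmx1_unit.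
have := CkMx_inv_open ab cS It0 uS.
move=> /(exists_sub_itv ab It0)[c [d [cd ac db _ uSt]]].
have cS' : CkMx `[c, d]%classic k S by exact: CkMx_sub cS.
have cV := CkMx_inv cd uSt cS'.
exists c, d; split=> //.
exists C, (fun t => rsubmx (invmx (S t))), (fun t => lsubmx (invmx (S t))); split.
- by move=> i j; apply: CkI_ext (cV i (rshift q j)) => // s _; rewrite mxE.
- by move=> i j; apply: CkI_ext (cV i (lshift r j)) => // s _; rewrite mxE.
move=> t tcd; have := mulmxV (uSt t tcd).
rewrite -[X in _ *m X]hsubmxK mul_col_row scalar_mx_block => /eq_block_mx[e1 e2 e3 e4].
split=> //; rewrite -scalar_mx_block addrC -mul_row_col hsubmxK mulVmx//.
exact: uSt.
Qed.

End SmoothComplements.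


(** * Formal solutions and reduction of the pencil *)

Definition dae_op (R : realType) (I : set R) (r n m : nat) (E A : R -> 'M[R]_(r, n))
    (x : R -> 'M[R]_(n, m)) : R -> 'M[R]_(r, m) :=
  fun t => E t *m derivMx I x t - A t *m x t.

(** Initial values of formal solutions to order [k]. A polynomial [phi] costs no smoothness and
    serves unchanged on every subinterval. *)
Definition jet_solution (R : realType) (I : set R) (n : nat) (E A : R -> 'M[R]_n)
    (k : nat) (x : 'cV[R]_n) (t : R) : Prop :=
  exists phi : R -> 'cV[R]_n,
    [/\ poly_fun phi, flatMx I k (dae_op I E A phi) t & phi t = x].

Definition jet_surjective (R : realType) (I : set R) (n : nat) (E A : R -> 'M[R]_n)
    (k : nat) (t : R) : Prop :=
  forall g : R -> 'cV[R]_n, poly_fun g -> exists2 phi : R -> 'cV[R]_n,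
    poly_fun phi & flatMx I k (fun s => dae_op I E A phi s - g s) t.

Section DaeOp.
Variables (R : realType) (a b : R).
Hypothesis ab : a < b.
Local Notation I := `[a, b]%classic.

Lemma CkMx_dae_op k r n m (E A : R -> 'M[R]_(r, n)) (x : R -> 'M[R]_(n, m)) :
  CkMx I k E -> CkMx I k A -> CkMx I k.+1 x -> CkMx I k (dae_op I E A x).
Proof.
move=> cE cA cx; apply: CkMxB => //; apply: CkMxM => //; first exact: CkMx_deriv.
exact: CkMx_le cx.
Qed.

Lemma flatMx_dae_op k r n m (E A : R -> 'M[R]_(r, n)) (x : R -> 'M[R]_(n, m)) t : I t ->
  CkMx I k E -> CkMx I k A -> flatMx I k.+1 x t -> flatMx I k (dae_op I E A x) t.
Proof.
move=> It cE cA fx; apply: flatMxB => //; apply: flatMxM => //; first exact: flatMx_deriv.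
exact: flatMx_le fx.
Qed.

Lemma dae_op_ext r n m (E A : R -> 'M[R]_(r, n)) (x y : R -> 'M[R]_(n, m)) t :
  (forall s, I s -> x s = y s) -> I t -> dae_op I E A x t = dae_op I E A y t.
Proof.
move=> xy It; rewrite /dae_op (xy t It); congr (_ *m _ - _).
by apply/matrixP => i j; rewrite !mxE; apply: derivI_ext => // s Is; rewrite xy.
Qed.

Lemma dae_opE r n m (E A : R -> 'M[R]_(r, n)) (x : R -> 'M[R]_(n, m)) t x' :
  I t -> is_dMx I x t x' -> dae_op I E A x t = E t *m x' - A t *m x t.
Proof. by move=> It dx; rewrite /dae_op (is_dMx_derivMx ab It dx). Qed.

Lemma dae_opB k r n m (E A : R -> 'M[R]_(r, n)) (x y : R -> 'M[R]_(n, m)) t : I t ->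
  CkMx I k.+1 x -> CkMx I k.+1 y ->
  dae_op I E A (fun s => x s - y s) t = dae_op I E A x t - dae_op I E A y t.
Proof.
move=> It cx cy; rewrite (dae_opE _ _ It (is_dMxB (CkMx_dMx cx It) (CkMx_dMx cy It))).
rewrite /dae_op !mulmxBr !opprB addrACA [RHS]addrACA; congr (_ + _); exact: addrC.
Qed.

Lemma poly_cst n m (C : 'M[R]_(n, m)) : poly_fun (fun=> C).
Proof. by move=> i j; exists (C i j)%:P => s; rewrite hornerC. Qed.

Lemma poly_funD n m (x y : R -> 'M[R]_(n, m)) :
  poly_fun x -> poly_fun y -> poly_fun (fun s => x s + y s).
Proof.
move=> px py i j; have [p hp] := px i j; have [q hq] := py i j.
by exists (p + q) => s; rewrite mxE hornerD hp hq.
Qed.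

Lemma jet_solution0 n (E A : R -> 'M[R]_n) x t : I t -> CkMx I 0 E -> CkMx I 0 A ->
  jet_solution I E A 0 x t.
Proof.
move=> It cE cA; exists (fun=> x); split=> //; first exact: poly_cst.
apply/flatMxP; split=> //; apply: CkMx_dae_op => //; exact: CkMx_cst.
Qed.

Lemma flatMx_top k m n (x : R -> 'M[R]_(m, n)) t :
  CkMx I k.+1 x -> flatMx I k x t -> derivnMx I k x t = 0 -> flatMx I k.+1 x t.
Proof.
move=> cx /flatMxP[_ H] e; apply/flatMxP; split=> // i.
by rewrite ltnS leq_eqVlt => /predU1P[->//|]; exact: H.
Qed.

Lemma derivnMx_flatM k m n p (X : R -> 'M[R]_(m, n)) (Y : R -> 'M[R]_(n, p)) t : I t ->
  CkMx I k X -> CkMx I k Y -> flatMx I k Y t ->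
  derivnMx I k (fun s => X s *m Y s) t = X t *m derivnMx I k Y t.
Proof.
move=> It cX cY /flatMxP[_ fY]; rewrite (derivnMxM ab)// big_ord_recr /= binn scale1r subnn.
rewrite big1 ?add0r// => i _; rewrite fY// mulmx0 scaler0//.
Qed.

End DaeOp.

(** * Independence of jets from the interval *)

Section Restriction.
Variables (R : realType) (a b c d : R).
Hypotheses (ab : a < b) (cd : c < d) (ac : a <= c) (db : d <= b).
Local Notation I := `[a, b]%classic.
Local Notation J := `[c, d]%classic.

Let JI t : J t -> I t. Proof. exact: sub_itv_cc. Qed.

Lemma derivnMx_sub k m n (X : R -> 'M[R]_(m, n)) t : J t -> CkMx I k X ->
  derivnMx I k X t = derivnMx J k X t.
Proof.
elim: k X t => [//|k IH] X t Jt cX; rewrite !derivnMxS IH; [|exact: Jt|exact: CkMx_deriv].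
apply: derivnMx_ext; [|exact: Jt] => s Js; apply/matrixP => i j; rewrite !mxE (derivI_sub cd ac db)//.
by apply: (cX i j).1; exact: JI.
Qed.

Lemma flatMx_sub k m n (X : R -> 'M[R]_(m, n)) t : J t -> CkMx I k X ->
  flatMx I k X t <-> flatMx J k X t.
Proof.
move=> Jt cX; split=> /flatMxP[_ H]; apply/flatMxP; split=> //; first exact: CkMx_sub cX.
  by move=> i ik; rewrite -derivnMx_sub ?H//; apply: CkMx_le cX; exact: ltnW.
by move=> i ik; rewrite derivnMx_sub ?H//; apply: CkMx_le cX; exact: ltnW.
Qed.

Lemma dae_op_sub r n m (E A : R -> 'M[R]_(r, n)) (x : R -> 'M[R]_(n, m)) t : J t ->
  CkMx I 1 x -> dae_op I E A x t = dae_op J E A x t.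
Proof.
move=> Jt cx; rewrite /dae_op; congr (_ *m _ - _).
apply/matrixP => i j; rewrite !mxE (derivI_sub cd ac db)//.
by apply: (cx i j).1; exact: JI.
Qed.

Variables (k n : nat) (E A : R -> 'M[R]_n).
Hypotheses (cE : CkMx I k E) (cA : CkMx I k A).

Lemma flat_dae_op_sub (phi g : R -> 'cV[R]_n) t : J t -> poly_fun phi -> CkMx I k g ->
  flatMx I k (fun s => dae_op I E A phi s - g s) t <->
  flatMx J k (fun s => dae_op J E A phi s - g s) t.
Proof.
move=> Jt pphi cg.
have cO : CkMx I k (fun s => dae_op I E A phi s - g s).
  by apply: (CkMxB ab) cg; apply: (CkMx_dae_op ab cE cA); exact: (poly_fun_Ck ab).
have [F1 F2] := flatMx_sub Jt cO.
have O s : J s -> dae_op I E A phi s = dae_op J E A phi s.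
  by move=> Js; apply: dae_op_sub Js _; exact: poly_fun_Ck.
split=> [/F1|F]; last apply: F2.
  by apply: (flatMx_ext cd) Jt => s Js; rewrite O.
by apply: (flatMx_ext cd) Jt F => s Js; rewrite O.
Qed.

Lemma jet_surjective_sub t : J t -> jet_surjective I E A k t -> jet_surjective J E A k t.
Proof.
move=> Jt H g pg; have [phi pphi fphi] := H g pg; exists phi; first exact: pphi.
by have [F _] := flat_dae_op_sub Jt pphi (poly_fun_Ck ab k pg); exact: F.
Qed.

Lemma jet_solution_sub x t : J t -> jet_solution J E A k x t <-> jet_solution I E A k x t.
Proof.
move=> Jt; split=> -[phi [pphi fphi e]]; exists phi; split=> //.
all: have [F1 F2] := flat_dae_op_sub Jt pphi (CkMx_cst ab k (0 : 'cV[R]_n)).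
  apply: (flatMx_ext ab) (JI Jt) (F2 _) => [s _|]; first by rewrite subr0.
  by apply: (flatMx_ext cd) Jt fphi => s _; rewrite subr0.
apply: (flatMx_ext cd) (Jt) (F1 _) => [s _|]; first by rewrite subr0.
by apply: (flatMx_ext ab) (JI Jt) fphi => s _; rewrite subr0.
Qed.

End Restriction.


(** * One reduction step of the pencil *)

Section ReductionStep.
Variables (R : realType) (a b : R).
Hypothesis ab : a < b.
Local Notation I := `[a, b]%classic.
Variables (k n r q : nat) (E A : R -> 'M[R]_n).
Variables (C : 'M[R]_(r, n)) (H : 'M[R]_(n, q)) (P : R -> 'M[R]_(n, r))
  (B0 : R -> 'M[R]_(q, n)) (G : R -> 'M[R]_(n, r)) (C0 : 'M[R]_(r, n))
  (K K' : R -> 'M[R]_(n, r)) (L : R -> 'M[R]_(n, q)).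
Let B t := B0 t *m A t.
Hypotheses (cE : CkMx I k.+1 E) (cA : CkMx I k.+1 A) (cP : CkMx I k.+1 P)
  (cB0 : CkMx I k.+1 B0) (cK : CkMx I k.+1 K) (cL : CkMx I k.+1 L) (cK' : CkMx I k K')
  (dK : forall t, I t -> is_dMx I K t (K' t)).
Hypotheses (hP : forall t, I t -> P t *m (C *m E t) = E t)
  (hPH : forall t, I t -> P t *m C + H *m B0 t = 1%:M)
  (hCP : forall t, I t -> C *m P t = 1%:M)
  (hB0E : forall t, I t -> B0 t *m E t = 0)
  (hB0H : forall t, I t -> B0 t *m H = 1%:M)
  (hG : forall t, I t -> C *m E t *m G t = 1%:M).
Hypotheses (hBK : forall t, I t -> B t *m K t = 0)
  (hKL : forall t, I t -> K t *m C0 + L t *m B t = 1%:M).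

(** Coefficients of the operator sending y to C [dae_op] (K y): the unknown is restricted to ker B,
    and C discards the algebraic rows. The term E K' comes from differentiating K y. *)
Definition red_E t : 'M[R]_r := C *m E t *m K t.
Definition red_A t : 'M[R]_r := C *m (A t *m K t - E t *m K' t).

Let cEk : CkMx I k E. Proof. exact: CkMx_le cE. Qed.
Let cAk : CkMx I k A. Proof. exact: CkMx_le cA. Qed.
Let cB : CkMx I k.+1 B. Proof. exact: CkMxM. Qed.
Let cC j : CkMx I j (fun=> C). Proof. exact: CkMx_cst. Qed.

Lemma CkMx_red_E : CkMx I k red_E.
Proof. by apply: CkMxM => //; [apply: CkMxM|exact: CkMx_le cK]. Qed.

Lemma CkMx_red_A : CkMx I k red_A.
Proof.
apply: CkMxM => //; apply: CkMxB => //; apply: CkMxM => //.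
exact: CkMx_le cK.
Qed.

Lemma red_dae_op m (y : R -> 'M[R]_(r, m)) t y' : I t -> is_dMx I y t y' ->
  C *m dae_op I E A (fun s => K s *m y s) t = red_E t *m y' - red_A t *m y t.
Proof.
move=> It dy; rewrite (dae_opE ab _ _ It (is_dMxM (dK It) dy)).
have zE (V : zmodType) (u v w : V) : u + v - w = v - (w - u).
  by rewrite opprB addrCA addrA.
by rewrite /red_E /red_A !mulmxDr !mulmxN !mulmxDl !mulNmx !mulmxA zE.
Qed.

Lemma B0_dae_op m (x : R -> 'M[R]_(n, m)) t : I t ->
  B0 t *m dae_op I E A x t = - (B t *m x t).
Proof. by move=> It; rewrite /dae_op mulmxBr mulmxA hB0E// mul0mx sub0r mulmxA. Qed.

Lemma split_PH m (x : 'M[R]_(n, m)) t : I t -> x = P t *m (C *m x) + H *m (B0 t *m x).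
Proof. by move=> It; rewrite !mulmxA -mulmxDl hPH// mul1mx. Qed.

Lemma split_KL m (x : 'M[R]_(n, m)) t : I t -> x = K t *m (C0 *m x) + L t *m (B t *m x).
Proof. by move=> It; rewrite 2!mulmxA -mulmxDl hKL// mul1mx. Qed.

(** The algebraic rows give B phi = - B0 [dae_op] phi without differentiating phi, so B phi is flat
    to the full order k + 1. In phi = K C0 phi + L B phi, applying [dae_op] to the flat second term
    costs one order; hence order k for the reduced equation. Data with B0 g = 0 are allowed for the
    sake of surjectivity. *)
Lemma red_flat (phi g : R -> 'cV[R]_n) t : I t -> poly_fun phi -> CkMx I k.+1 g ->
  (forall s, I s -> B0 s *m g s = 0) ->
  flatMx I k.+1 (fun s => dae_op I E A phi s - g s) t ->
  flatMx I k.+1 (fun s => B s *m phi s) t /\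
  flatMx I k (fun s => dae_op I red_E red_A (fun u => C0 *m phi u) s - C *m g s) t.
Proof.
move=> It pphi cg B0g fphi.
have fB : flatMx I k.+1 (fun s => B s *m phi s) t.
  apply: (flatMx_ext ab) It (flatMxN ab It (flatMxM ab It cB0 fphi)) => s Is.
  by rewrite mulmxBr B0_dae_op// B0g// subr0 opprK.
split=> //.
have cphi j : CkMx I j phi by exact: poly_fun_Ck.
have cy j : CkMx I j (fun u => C0 *m phi u) by apply: poly_fun_Ck => //; exact: poly_funM.
have fL : flatMx I k.+1 (fun s => L s *m (B s *m phi s)) t by exact: flatMxM.
have f1 : flatMx I k (fun s => C *m (dae_op I E A phi s - g s)) t.
  by apply: flatMxM => //; exact: flatMx_le fphi.
have f2 : flatMx I k (fun s => C *m dae_op I E A (fun u => L u *m (B u *m phi u)) s) t.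
  by apply: flatMxM => //; exact: flatMx_dae_op.
apply: (flatMx_ext ab) It (flatMxB ab It f1 f2) => s Is.
have dy : is_dMx I (fun u => C0 *m phi u) s (derivMx I (fun u => C0 *m phi u) s).
  exact: CkMx_dMx (cy 1%N) Is.
rewrite (dae_opE ab red_E red_A Is dy) -(red_dae_op Is dy).
have -> : dae_op I E A (fun u => K u *m (C0 *m phi u)) s =
    dae_op I E A phi s - dae_op I E A (fun u => L u *m (B u *m phi u)) s.
  rewrite -(dae_opB ab (k := 0))//; last first.
    by apply: CkMxM => //; [exact: CkMx_le cL|apply: CkMxM => //; exact: CkMx_le cB].
  apply: dae_op_ext => // u Iu; rewrite {2}(split_KL (phi u) Iu).
  by rewrite addrK.
by rewrite !mulmxBr addrAC.
Qed.

Lemma jet_solution_red x t : I t -> jet_solution I E A k.+1 x t ->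
  B t *m x = 0 /\ jet_solution I red_E red_A k (C0 *m x) t.
Proof.
move=> It [phi [pphi fphi phix]].
have [||f1 f2] := @red_flat phi (fun=> 0) t It pphi (CkMx_cst ab _ _).
- by move=> s _; rewrite mulmx0.
- by apply: (flatMx_ext ab) It fphi => s _; rewrite subr0.
split; first by have := flatMx_val f1; rewrite phix.
exists (fun s => C0 *m phi s); split; [exact: poly_funM| |by rewrite phix].
by apply: (flatMx_ext ab) It f2 => s _; rewrite mulmx0 subr0.
Qed.

(* [K y] satisfies the equation to one order less than required; adding a multiple of
   (s - t)^(k+1) / (k+1)! corrects the last derivative because [C *m E] is onto. *)
Lemma jet_solution_lift y t : I t -> jet_solution I red_E red_A k y t ->
  jet_solution I E A k.+1 (K t *m y) t.
Proof.
move=> It [phi [pphi fphi phiy]].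
have cphi j : CkMx I j phi by exact: poly_fun_Ck.
have cKphi : CkMx I k.+1 (fun s => K s *m phi s) by exact: CkMxM.
have [psi ppsi fpsi] := taylorMx ab It cKphi.
have cpsi j : CkMx I j psi by exact: poly_fun_Ck.
have f1 : flatMx I k (fun s => C *m dae_op I E A psi s) t.
  have f3 : flatMx I k (fun s => C *m dae_op I E A (fun u => K u *m phi u - psi u) s) t.
    by apply: flatMxM => //; exact: flatMx_dae_op.
  apply: (flatMx_ext ab) It (flatMxB ab It fphi f3) => s Is.
  rewrite (dae_opB ab (k := 0))//; last exact: CkMx_le cKphi.
  rewrite mulmxBr (red_dae_op Is (CkMx_dMx (cphi 1%N) Is)) opprB addrCA.
  by rewrite /dae_op subrr addr0.
pose w := derivnMx I k (fun s => C *m dae_op I E A psi s) t.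
(* Chosen so that C E u = - w at [t], where [w] is the derivative that obstructs flatness to order k
   + 1. *)
pose u : 'cV[R]_n := - (G t *m w).
have [tau ptau htau] := poly_jetMx ab k.+2 (fun i => if i == k.+1 then 1%:M : 'M[R]_1 else 0) It.
pose T s : 'cV[R]_n := u *m tau s.
have pT : poly_fun T by exact: poly_funM.
have cT j : CkMx I j T by exact: poly_fun_Ck.
have fT : flatMx I k.+1 T t.
  apply: flatMxM => //; first exact: CkMx_cst.
  apply/flatMxP; split; first exact: poly_fun_Ck.
  by move=> i ik; rewrite htau ?ltn_eqF//; exact: ltnW.
have topT : derivnMx I k (derivMx I T) t = u.
  rewrite -derivnMxS (derivnMx_flatM ab)//; last 3 first.
  - exact: CkMx_cst.
  - exact: poly_fun_Ck.
  - apply/flatMxP; split; first exact: poly_fun_Ck.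
    by move=> i ik; rewrite htau ?ltn_eqF//; exact: ltnW.
  by rewrite htau// eqxx mulmx1.
have cdT j : CkMx I j (derivMx I T) by apply: CkMx_deriv.
have fdT : flatMx I k (derivMx I T) t by exact: flatMx_deriv.
have fLT : flatMx I k (fun s => C *m dae_op I E A T s) t.
  by apply: flatMxM => //; exact: flatMx_dae_op.
(* T vanishes to order k + 1, so at order k only the term C E T' with all derivatives on T'
   survives. *)
have topLT : derivnMx I k (fun s => C *m dae_op I E A T s) t = - w.
  have -> : derivnMx I k (fun s => C *m dae_op I E A T s) t =
      derivnMx I k (fun s => C *m E s *m derivMx I T s + (-1) *: (C *m A s *m T s)) t.
    by apply: derivnMx_ext => // s _; rewrite /dae_op mulmxBr !mulmxA scaleN1r.
  rewrite (derivnMx_lin ab)//; last 2 first.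
  - by apply: CkMxM => //; exact: CkMxM.
  - by apply: CkMxM => //; exact: CkMxM.
  rewrite (derivnMx_flatM ab)//; last by apply: CkMxM.
  have -> : derivnMx I k (fun s => C *m A s *m T s) t = 0.
    have /flatMxP[_] : flatMx I k.+1 (fun s => C *m A s *m T s) t.
      by apply: flatMxM => //; apply: CkMxM.
    by apply.
  by rewrite scaler0 addr0 topT /u mulmxN mulmxA hG// mul1mx.
exists (fun s => psi s + T s); split; first exact: poly_funD.
  have cO : CkMx I k.+1 (dae_op I E A (fun s => psi s + T s)).
    by apply: CkMx_dae_op => //; apply: CkMxD.
  have opD s : I s -> dae_op I E A (fun s => psi s + T s) s = dae_op I E A psi s + dae_op I E A T s.
    move=> Is; rewrite (dae_opE ab _ _ Is (is_dMxD (CkMx_dMx (cpsi 1%N) Is) (CkMx_dMx (cT 1%N) Is))).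
    by rewrite /dae_op !mulmxDr opprD addrACA.
  have g1 : flatMx I k.+1 (fun s => C *m dae_op I E A (fun s => psi s + T s) s) t.
    apply: flatMx_top; first by apply: CkMxM.
      apply: (flatMx_ext ab) It (flatMxD ab It f1 fLT) => s Is.
      by rewrite -mulmxDr -(opD _ Is).
    have -> : derivnMx I k (fun s => C *m dae_op I E A (fun s => psi s + T s) s) t =
        derivnMx I k (fun s => C *m dae_op I E A psi s + 1 *: (C *m dae_op I E A T s)) t.
      by apply: derivnMx_ext => // s Is; rewrite (opD _ Is) scale1r mulmxDr.
    rewrite (derivnMx_lin ab)//; last 2 first.
    - by apply: CkMxM => //; exact: CkMx_dae_op.
    - by apply: CkMxM => //; exact: CkMx_dae_op.
    by rewrite topLT scale1r addrN.
  (* Since B K = 0, B psi differs from zero only by the Taylor remainder: the algebraic rows already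
     hold to order k + 1. *)
  have g2 : flatMx I k.+1 (fun s => B s *m (psi s + T s)) t.
    apply: (flatMx_ext ab) It (flatMxB ab It (flatMxM ab It cB fT) (flatMxM ab It cB fpsi)) => s Is.
    by rewrite mulmxBr [B s *m (K s *m _)]mulmxA (hBK Is) mul0mx sub0r opprK mulmxDr addrC.
  have g3 := flatMxB ab It (flatMxM ab It cP g1) (flatMxM ab It (CkMx_cst ab _ H) g2).
  apply: (flatMx_ext ab) It g3 => s Is.
  by rewrite [RHS](split_PH _ Is) B0_dae_op// mulmxN.
have := flatMx_val fpsi; have -> : T t = 0 by exact: flatMx_val fT.
by rewrite phiy addr0 => /eqP; rewrite subr_eq0 => /eqP.
Qed.

(** The datum g is lifted to P g, for which C P g = g and B0 P g = 0, so the algebraic equations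
    stay homogeneous. A Taylor polynomial replaces P g because surjectivity concerns polynomial
    data. *)
Lemma jet_surjective_red t : I t -> jet_surjective I E A k.+1 t ->
  jet_surjective I red_E red_A k t.
Proof.
move=> It surj g pg.
have cg j : CkMx I j g by exact: poly_fun_Ck.
have cPg : CkMx I k.+1 (fun s => P s *m g s) by exact: CkMxM.
have [g' pg' fg'] := taylorMx ab It cPg.
have [phi pphi fphi] := surj g' pg'.
have B0P s : I s -> B0 s *m (P s *m g s) = 0.
  move=> Is; rewrite -[B0 s *m _]mul1mx -(hB0H Is) -mulmxA.
  have -> : H *m (B0 s *m (P s *m g s)) = 0; last by rewrite mulmx0.
  have := split_PH (P s *m g s) Is; rewrite [C *m _]mulmxA hCP// mul1mx.
  by rewrite -[LHS]addr0 => /addrI <-.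
have [|_ f2] := @red_flat phi (fun s => P s *m g s) t It pphi cPg B0P.
- apply: (flatMx_ext ab) It (flatMxB ab It fphi fg') => s _.
  by rewrite opprB addrA subrK.
exists (fun s => C0 *m phi s); first exact: poly_funM.
by apply: (flatMx_ext ab) It f2 => s Is; rewrite mulmxA hCP// mul1mx.
Qed.

End ReductionStep.


(* [dae_solvable] is the range condition L K = E K X stated without a basis of the
   space of jet solutions, [dae_separating] the dual property of row functions. *)
Definition dae_solvable (R : realType) (J : set R) (n : nat) (E A : R -> 'M[R]_n) (k : nat) : Prop :=
  forall x : R -> 'cV[R]_n, CkMx J 1 x ->
    (forall t, J t -> jet_solution J E A k (x t) t) ->
    forall t, J t -> exists2 z, jet_solution J E A k z t & dae_op J E A x t = E t *m z.

Definition dae_separating (R : realType) (J : set R) (n : nat) (E A : R -> 'M[R]_n) (k : nat) : Prop :=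
  forall xi : R -> 'rV[R]_n,
    (forall t, J t -> is_dMx J (fun s => xi s *m E s) t (- (xi t *m A t))) ->
    (forall t, J t -> forall z, jet_solution J E A k z t -> xi t *m E t *m z = 0) ->
    forall t, J t -> xi t *m E t = 0.

Lemma col_inj_unitmx (F : fieldType) n (X : 'M[F]_n) :
  (forall v : 'cV_n, X *m v = 0 -> v = 0) -> X \in unitmx.
Proof.
move=> H; rewrite -unitmx_tr -row_free_unit; apply: inj_row_free => v vX.
by apply: trmx_inj; rewrite trmx0; apply: H; apply: trmx_inj; rewrite trmx_mul trmxK trmx0.
Qed.

Lemma mulmx_eq0P (R : pzRingType) m n (X : 'M[R]_(m, n)) :
  (forall v : 'cV_n, X *m v = 0) -> X = 0.
Proof.
move=> H; apply/matrixP => i j; have /matrixP/(_ i 0) := H (delta_mx j 0).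
by rewrite -colE !mxE.
Qed.

(** At positive order, evaluate at [t] a jet solution for the constant datum [w]. At order 0
    flatness says nothing, but every vector is a jet solution and injectivity makes E t
    invertible. *)
Lemma pencil_onto (R : realType) (a b : R) (k n : nat) (E A : R -> 'M[R]_n) t : a < b ->
  CkMx `[a, b]%classic 0 E -> CkMx `[a, b]%classic 0 A -> `[a, b]%classic t ->
  jet_surjective `[a, b]%classic E A k t ->
  (forall x, jet_solution `[a, b]%classic E A k x t -> E t *m x = 0 -> x = 0) ->
  forall w : 'cV[R]_n, exists p p', w = E t *m p - A t *m p'.
Proof.
move=> ab cE cA It; case: k => [_ inj|k surj _] w.
  have uE : E t \in unitmx.
    by apply: col_inj_unitmx => v; apply: inj; exact: (jet_solution0 ab).
  by exists (invmx (E t) *m w), 0; rewrite mulmx0 subr0 mulKVmx.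
have [phi _ /flatMx_val /eqP] := surj (fun=> w) (poly_cst w).
by rewrite subr_eq0 => /eqP <-; exists (derivMx `[a, b]%classic phi t), (phi t).
Qed.

(** Induction on [k] for all sizes [n] at once. Each step costs one derivative and two shrinkings of
    the interval: to make the rank of E constant, and to keep a constant complement of B. At k = 0
    the matrix E is invertible and both conclusions are immediate. *)
Lemma exists_regular_subitv (R : realType) k n (E A : R -> 'M[R]_n) (a b : R) : a < b ->
  CkMx `[a, b]%classic k E -> CkMx `[a, b]%classic k A ->
  (forall t, `[a, b]%classic t -> jet_surjective `[a, b]%classic E A k t) ->
  (forall t, `[a, b]%classic t -> forall x, jet_solution `[a, b]%classic E A k x t ->
     E t *m x = 0 -> x = 0) ->
  exists c d, [/\ c < d, a <= c, d <= b, dae_solvable `[c, d]%classic E A k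
    & dae_separating `[c, d]%classic E A k].
Proof.
elim: k n E A a b => [|k IH] n E A a b ab cE cA surj inj.
  have uE t : `[a, b]%classic t -> E t \in unitmx.
    by move=> It; apply: col_inj_unitmx => v; apply: inj => //; exact: (jet_solution0 ab).
  exists a, b; split=> //.
    move=> x cx _ t It; exists (invmx (E t) *m dae_op `[a, b]%classic E A x t).
      exact: (jet_solution0 ab).
    by rewrite mulKVmx// uE.
  move=> xi _ H t It; apply: mulmx_eq0P => v; apply: (H t It).
  exact: (jet_solution0 ab).
have [c1 [d1 [r [q [cd1 ac1 db1 qr [C [H [P [B0 [G [cP1 cB01 h1]]]]]]]]]]] :=
  local_rank_factorization ab cE.
have sub1 := sub_itv_cc ac1 db1.
have c1J : `[c1, d1]%classic c1 by rewrite /= in_itv /= lexx ltW.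
have cA1 : CkMx `[c1, d1]%classic k.+1 A by apply: CkMx_sub cA.
have cE1 : CkMx `[c1, d1]%classic k.+1 E by apply: CkMx_sub cE.
have cB1 := CkMxM cd1 cB01 cA1.
have surj1 t (Jt : `[c1, d1]%classic t) : jet_surjective `[c1, d1]%classic E A k.+1 t.
  exact: (jet_surjective_sub ab cd1 ac1 db1 cE cA Jt (surj t (sub1 t Jt))).
(* If v B0 A = 0, then v B0 annihilates E and A, hence every value of [dae_op]; by surjectivity
   these values fill the space, and B0 has a right inverse. *)
have fB : row_free (B0 c1 *m A c1).
  have [[_ _ _ hB0H hB0E] _] := h1 _ c1J.
  apply: inj_row_free => v vB.
  suff vB0 : v *m B0 c1 = 0 by rewrite -[v]mulmx1 -hB0H mulmxA vB0 mul0mx.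
  apply: mulmx_eq0P => w; have [phi _ /flatMx_val /eqP] := surj1 _ c1J (fun=> w) (poly_cst w).
  rewrite subr_eq0 => /eqP <-; rewrite /dae_op mulmxBr !mulmxA.
  rewrite -[v *m B0 c1 *m E c1]mulmxA hB0E mulmx0 mul0mx sub0r.
  by rewrite -[v *m B0 c1 *m A c1]mulmxA vB mul0mx oppr0.
have [c2 [d2 [cd2 ac2 db2 [C0 [K [L [cK cL h2]]]]]]] :=
  local_smooth_complement cd1 qr cB1 c1J fB.
have sub2 := sub_itv_cc ac2 db2.
pose J2 := `[c2, d2]%classic : set R.
pose K' := derivMx J2 K.
have cK' : CkMx J2 k K' by exact: (CkMx_deriv cd2).
have dK t : J2 t -> is_dMx J2 K t (K' t) by move=> Jt; exact: CkMx_dMx cK Jt.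
have cE2 : CkMx J2 k.+1 E by apply: CkMx_sub cE1.
have cA2 : CkMx J2 k.+1 A by apply: CkMx_sub cA1.
have cP2 : CkMx J2 k.+1 P by apply: CkMx_sub cP1.
have cB02 : CkMx J2 k.+1 B0 by apply: CkMx_sub cB01.
have hP t (Jt : J2 t) : P t *m (C *m E t) = E t by have [[]] := h1 t (sub2 t Jt).
have hPH t (Jt : J2 t) : P t *m C + H *m B0 t = 1%:M by have [[]] := h1 t (sub2 t Jt).
have hCP t (Jt : J2 t) : C *m P t = 1%:M by have [[]] := h1 t (sub2 t Jt).
have hB0H t (Jt : J2 t) : B0 t *m H = 1%:M by have [[]] := h1 t (sub2 t Jt).
have hB0E t (Jt : J2 t) : B0 t *m E t = 0 by have [[]] := h1 t (sub2 t Jt).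
have hG t (Jt : J2 t) : C *m E t *m G t = 1%:M by have [] := h1 t (sub2 t Jt).
have hBK t (Jt : J2 t) : B0 t *m A t *m K t = 0 by have [] := h2 t Jt.
have hC0K t (Jt : J2 t) : C0 *m K t = 1%:M by have [] := h2 t Jt.
have hKL t (Jt : J2 t) : K t *m C0 + L t *m (B0 t *m A t) = 1%:M by have [] := h2 t Jt.
have ac : a <= c2 by exact: le_trans ac2.
have db : d2 <= b by exact: le_trans db1.
have sub := sub_itv_cc ac db.
pose E' := red_E E C K; pose A' := red_A E A C K K'.
have surj' t : J2 t -> jet_surjective J2 E' A' k t.
  move=> Jt; apply: (jet_surjective_red cd2 cE2 cA2 cP2 cB02 cL dK hPH hCP hB0E hB0H hKL Jt).
  exact: (jet_surjective_sub cd1 cd2 ac2 db2 cE1 cA1 Jt (surj1 t (sub2 t Jt))).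
(* A reduced jet solution x lifts to K x, and E K x = P (C E K) x = 0; so K x = 0, and C0 K = 1
   gives x = 0. *)
have inj' t : J2 t -> forall x, jet_solution J2 E' A' k x t -> E' t *m x = 0 -> x = 0.
  move=> Jt x sx Ex.
  have sKx := jet_solution_lift cd2 cE2 cA2 cP2 cB02 cK dK hPH hB0E hG hBK Jt sx.
  have e : E t *m (K t *m x) = 0.
    by rewrite -(hP t Jt) -mulmxA [C *m E t *m _]mulmxA Ex mulmx0.
  have := inj t (sub t Jt) _ ((jet_solution_sub ab cd2 ac db cE cA _ Jt).1 sKx) e.
  by move=> /(congr1 (mulmx C0)); rewrite mulmxA hC0K// mul1mx mulmx0.
have cE' : CkMx J2 k E' by exact: (CkMx_red_E cd2).
have cA' : CkMx J2 k A' by exact: (CkMx_red_A cd2).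
have [c [d [cd ac' db' solv sep]]] := IH r E' A' c2 d2 cd2 cE' cA' surj' inj'.
have sub3 := sub_itv_cc ac' db'.
pose J := `[c, d]%classic : set R.
have cE3 : CkMx J k.+1 E by apply: CkMx_sub cE2.
have cA3 : CkMx J k.+1 A by apply: CkMx_sub cA2.
have cP3 : CkMx J k.+1 P by apply: CkMx_sub cP2.
have cB03 : CkMx J k.+1 B0 by apply: CkMx_sub cB02.
have cK3 : CkMx J k.+1 K by apply: CkMx_sub cK.
have cL3 : CkMx J k.+1 L by apply: CkMx_sub cL.
have dK3 t : J t -> is_dMx J K t (K' t).
  by move=> Jt; apply: is_dMx_sub (dK t (sub3 t Jt)).
have hP3 t (Jt : J t) := hP t (sub3 t Jt).
have hPH3 t (Jt : J t) := hPH t (sub3 t Jt).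
have hB0E3 t (Jt : J t) := hB0E t (sub3 t Jt).
have hG3 t (Jt : J t) := hG t (sub3 t Jt).
have hBK3 t (Jt : J t) := hBK t (sub3 t Jt).
have hKL3 t (Jt : J t) := hKL t (sub3 t Jt).
have lift t (Jt : J t) y := jet_solution_lift (y := y) cd cE3 cA3 cP3 cB03 cK3 dK3 hPH3 hB0E3 hG3 hBK3 Jt.
exists c, d; split; [exact: cd|exact: le_trans ac ac'|exact: le_trans db' db| |].
  move=> x cx sx.
  have red t (Jt : J t) := jet_solution_red cd C cE3 cA3 cB03 cL3 dK3 hB0E3 hKL3 Jt (sx t Jt).
  (* B x = 0 forces x = K y with y = C0 x. The B0 rows of the residual vanish, and the remaining
     part is P times the reduced residual P E' z = E K z. *)
  have cy : CkMx J 1 (fun t => C0 *m x t) by apply: (CkMxM cd) cx; exact: (CkMx_cst cd).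
  move=> t Jt; have [|z sz ez] := solv _ cy _ t Jt.
    by move=> s Js; exact: (red s Js).2.
  exists (K t *m z); first exact: lift.
  rewrite (split_PH hPH3 (dae_op _ _ _ _ _) Jt) (B0_dae_op A hB0E3 x Jt) (red t Jt).1.
  rewrite oppr0 mulmx0 addr0.
  have -> : dae_op J E A x t = dae_op J E A (fun s => K s *m (C0 *m x s)) t.
    apply: dae_op_ext Jt => s Js.
    by rewrite {1}(split_KL hKL3 (x s) Js) (red s Js).1 mulmx0 addr0.
  rewrite (red_dae_op cd E A C dK3 Jt (CkMx_dMx cy Jt)).
  rewrite -[LHS]/(P t *m dae_op J E' A' (fun s => C0 *m x s) t) ez.
  by rewrite -(hP3 t Jt) /E' /red_E !mulmxA.
move=> xi dxi hxi.
(* B0 annihilates A K - E K', so xi P acts on the reduced coefficients as xi acts on E K and A K - E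
   K'; thus it solves the reduced adjoint equation. *)
pose xi1 t := xi t *m P t.
have xiE t : J t -> xi1 t *m E' t = xi t *m E t *m K t.
  by move=> Jt; rewrite -(hP3 t Jt) /xi1 /E' /red_E !mulmxA.
have xiA t : J t -> xi1 t *m A' t = xi t *m A t *m K t - xi t *m E t *m K' t.
  move=> Jt; rewrite -[RHS]addr0.
  have -> : xi t *m A t *m K t - xi t *m E t *m K' t = xi t *m (A t *m K t - E t *m K' t).
    by rewrite mulmxBr !mulmxA.
  rewrite (split_PH hPH3 (A t *m K t - E t *m K' t) Jt).
  rewrite [B0 t *m (_ - _)]mulmxBr !mulmxA (hBK3 t Jt) (hB0E3 t Jt) mul0mx subr0 mulmx0 !addr0.
  by rewrite /xi1 /A' /red_A !mulmxA.
have dxi1 t : J t -> is_dMx J (fun s => xi1 s *m E' s) t (- (xi1 t *m A' t)).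
  move=> Jt; apply: (is_dMx_ext (X := fun s => xi s *m E s *m K s)) (Jt) _.
    by move=> s Js; rewrite xiE.
  apply: is_dMx_eq; first exact: is_dMxM (dxi t Jt) (dK3 t Jt).
  by rewrite (xiA t Jt) opprB mulNmx addrC.
have xi1E0 t : J t -> xi1 t *m E' t = 0.
  move=> Jt; apply: (sep xi1 dxi1) Jt => s Js z sz; rewrite (xiE s Js) -mulmxA.
  exact: (hxi s Js _ (lift s Js z sz)).
have xi1A0 t : J t -> xi1 t *m A' t = 0.
  move=> Jt; have := is_dMx_derivMx cd Jt (dxi1 t Jt).
  rewrite (is_dMx_derivMx cd (X' := 0) Jt); last first.
    by apply: (is_dMx_ext (X := fun=> 0)) Jt (is_dMx_cst _ _ _ _) => s Js; rewrite xi1E0.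
  by move/eqP; rewrite eq_sym oppr_eq0 => /eqP.
move=> t Jt; rewrite -(hP3 t Jt) mulmxA.
(* Differentiating xi1 E' = 0 gave xi1 A' = 0 as well, and the reduced pencil is onto, so xi1 itself
   vanishes. *)
suff -> : xi t *m P t = 0 by rewrite mul0mx.
apply: mulmx_eq0P => w.
have [p [p' ->]] : exists p p', w = E' t *m p - A' t *m p'.
  have J2t := sub3 t Jt.
  exact: (pencil_onto cd2 (CkMx_le (leq0n k) cE') (CkMx_le (leq0n k) cA') J2t (surj' t J2t) (inj' t J2t)).
rewrite -/(xi1 t) mulmxBr [X in X - _]mulmxA [X in _ - X]mulmxA.
by rewrite (xi1E0 t Jt) (xi1A0 t Jt) !mul0mx subr0.
Qed.


(** * The derivative array *)

Section DerivativeArray.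
Variables (R : realType) (a b : R).
Hypothesis ab : a < b.
Local Notation I := `[a, b]%classic.
Variables (n mu : nat) (E A : R -> 'M[R]_n).
Hypotheses (cE : CkMx I mu.+1 E) (cA : CkMx I mu.+1 A).

(** Leibniz rule. Block column j multiplies the derivative of order j + 1 of phi, which shifts the
    A-sum by one and explains its binomials; the term left over carries phi itself and is the row of
    [Amu]. Binomials vanish beyond i. *)
Lemma derivnMx_dae_op i (phi : R -> 'cV[R]_n) t : I t -> (i < mu.+1)%N -> poly_fun phi ->
  derivnMx I i (dae_op I E A phi) t =
  \sum_(j < mu.+1) ('C(i, j)%:R *: derivnMx I (i - j) E t
     - 'C(i, j.+1)%:R *: derivnMx I (i - j - 1) A t) *m derivnMx I j.+1 phi t
  - derivnMx I i A t *m phi t.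
Proof.
move=> It im pphi.
have cphi k : CkMx I k phi by exact: (poly_fun_Ck ab).
have cdphi k : CkMx I k (derivMx I phi) by exact: (CkMx_deriv ab).
have cEi : CkMx I i E by apply: CkMx_le cE; exact: ltnW.
have cAi : CkMx I i A by apply: CkMx_le cA; exact: ltnW.
have -> : derivnMx I i (dae_op I E A phi) t =
    derivnMx I i (fun s => E s *m derivMx I phi s + (-1) *: (A s *m phi s)) t.
  by apply: derivnMx_ext It => s _; rewrite scaleN1r.
rewrite (derivnMx_lin ab); [|exact: It|exact: (CkMxM ab)|exact: (CkMxM ab)].
rewrite (derivnMxM ab It cEi (cdphi i)) (derivnMxM ab It cAi (cphi i)).
rewrite [X in _ + _ *: X]big_ord_recl /= bin0 scale1r subn0 scaleN1r opprD addrCA.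
rewrite [RHS]addrC; congr (_ + _).
under [RHS]eq_bigr do rewrite mulmxBl -!scalemxAl.
rewrite sumrB; congr (_ - _).
  rewrite (big_ord_widen mu.+1 (fun j => 'C(i, j)%:R *:
    (derivnMx I (i - j) E t *m derivnMx I j (derivMx I phi) t)))// big_mkcond /=.
  apply: eq_bigr => j _; rewrite -derivnMxS; case: ltnP => // ij.
  by rewrite bin_small// scale0r.
rewrite (big_ord_widen mu.+1 (fun j => 'C(i, j.+1)%:R *:
    (derivnMx I (i - j.+1) A t *m derivnMx I j.+1 phi t))) 1?ltnW// big_mkcond /=.
apply: eq_bigr => j _; rewrite -subnDA addn1; case: ltnP => // ij.
by rewrite bin_small// scale0r.
Qed.

Lemma derivative_array (phi : R -> 'cV[R]_n) t : I t -> poly_fun phi ->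
  \mxcol_(i < mu.+1) derivnMx I i (dae_op I E A phi) t =
  Mmu I E A mu t *m (\mxcol_(j < mu.+1) derivnMx I j.+1 phi t) - Amu I A mu t *m phi t.
Proof.
move=> It pphi; rewrite /Mmu mul_mxblock_mxrow /Amu mxcol_mul -mxcolB.
by apply: eq_mxcol => i; exact: derivnMx_dae_op.
Qed.

Lemma flat_derivative_array (phi g : R -> 'cV[R]_n) t : I t -> poly_fun phi -> CkMx I mu.+1 g ->
  flatMx I mu.+1 (fun s => dae_op I E A phi s - g s) t <->
  Mmu I E A mu t *m (\mxcol_(j < mu.+1) derivnMx I j.+1 phi t) - Amu I A mu t *m phi t =
  \mxcol_(i < mu.+1) derivnMx I i g t.
Proof.
move=> It pphi cg; rewrite -(derivative_array It pphi).
have cO : CkMx I mu.+1 (dae_op I E A phi).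
  by apply: (CkMx_dae_op ab cE cA); exact: (poly_fun_Ck ab).
have D i : (i < mu.+1)%N -> derivnMx I i (fun s => dae_op I E A phi s - g s) t =
    derivnMx I i (dae_op I E A phi) t - derivnMx I i g t.
  move=> im; rewrite -[- derivnMx _ _ _ _]scaleN1r -(derivnMx_lin ab)//.
  - by apply: derivnMx_ext It => s _; rewrite scaleN1r.
  - by apply: CkMx_le cO; exact: ltnW.
  - by apply: CkMx_le cg; exact: ltnW.
rewrite -eq_mxcolP; split=> [/flatMxP[_ H] i|H].
  by apply/eqP; rewrite -subr_eq0 -D// H.
apply/flatMxP; split; first exact: (CkMxB ab).
by move=> i im; rewrite D// (H (Ordinal im)) subrr.
Qed.

Lemma prescribed_jet (x : 'cV[R]_n) (y : 'cV[R]_(\sum_(i < mu.+1) n)) t : I t ->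
  exists2 phi : R -> 'cV[R]_n, poly_fun phi &
    phi t = x /\ \mxcol_(j < mu.+1) derivnMx I j.+1 phi t = y.
Proof.
move=> It.
have [phi pphi H] := poly_jetMx ab mu.+2
  (fun j => if j is j'.+1 then submxcol y (inord j') else x) It.
exists phi => //; split; first exact: (H 0%N).
rewrite -[RHS]submxcolK; apply: eq_mxcol => j.
by rewrite (H j.+1 (ltn_ord j)) inord_val.
Qed.

Variables (q : nat) (Z2 : R -> 'M[R]_(\sum_(i < mu.+1) n, q)) (t : R).
Hypotheses (It : I t) (rM : (\rank (Mmu I E A mu t) + q)%N = (mu.+1 * n)%N)
  (rZ : \rank (Z2 t) = q) (ZM : (Z2 t)^T *m Mmu I E A mu t = 0).

(** By the rank condition the columns of [Z2] fill the left kernel of [Mmu], so what they annihilate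
    is its range. *)
Lemma range_Mmu (w : 'cV[R]_(\sum_(i < mu.+1) n)) : (Z2 t)^T *m w = 0 ->
  exists y, w = Mmu I E A mu t *m y.
Proof.
move=> Zw; set M := Mmu I E A mu t.
have MZ : M^T *m Z2 t = 0 by apply: trmx_inj; rewrite trmx_mul trmxK trmx0.
have : (M^T <= kermx (Z2 t))%MS by apply/sub_kermxP.
have sN : (\sum_(i < mu.+1) n)%N = (mu.+1 * n)%N by rewrite sum_nat_const card_ord.
have gen (u v w' : nat) : (u + v)%N = w' -> (w' - v)%N = u by move=> <-; rewrite addnK.
move=> /mxrank_leqif_sup[_]; rewrite mxrank_ker rZ mxrank_tr.
rewrite (gen _ _ _ (etrans rM (esym sN))) eqxx => /esym sub.
have : (w^T <= kermx (Z2 t))%MS.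
  by apply/sub_kermxP; apply: trmx_inj; rewrite trmx_mul trmxK trmx0.
move=> /submx_trans/(_ sub)/submxP[y wy]; exists y^T.
by apply: trmx_inj; rewrite trmx_mul trmxK.
Qed.

(** Flatness to order mu + 1 says M y = [Amu] x, where y stacks the higher derivatives of phi. These
    can be prescribed freely, so only the solvability condition Z2^T [Amu] x = 0 remains. *)
Lemma jet_solutionP (x : 'cV[R]_n) :
  jet_solution I E A mu.+1 x t <-> A2hat I A Z2 t *m x = 0.
Proof.
have c0 : CkMx I mu.+1 (fun=> 0 : 'cV[R]_n) by exact: (CkMx_cst ab).
have d0 : \mxcol_(i < mu.+1) derivnMx I i (fun=> 0 : 'cV[R]_n) t = 0.
  rewrite -mxcol0; apply: eq_mxcol => i.
  have /flatMxP[_] : flatMx I mu.+1 (fun=> 0 : 'cV[R]_n) t.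
    move=> k l; apply: (flat_ext ab) (flat0 ab _ It) => //s _; by rewrite mxE.
  exact.
split=> [[phi [pphi fphi phix]]|Ax].
  have [F _] := flat_derivative_array It pphi c0.
  have /F : flatMx I mu.+1 (fun s => dae_op I E A phi s - 0) t.
    by apply: (flatMx_ext ab) It fphi => s _; rewrite subr0.
  rewrite d0 phix => /eqP; rewrite subr_eq0 => /eqP e.
  by rewrite /A2hat -mulmxA -e mulmxA ZM mul0mx.
have [|y My] := @range_Mmu (Amu I A mu t *m x); first by rewrite mulmxA.
have [phi pphi [phix phiy]] := prescribed_jet x y It.
exists phi; split=> //.
have [_ F] := flat_derivative_array It pphi c0.
apply: (flatMx_ext ab) (It) (F _) => [s _|]; first by rewrite subr0.
by rewrite phix phiy -My subrr d0.
Qed.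

(** A right inverse of A2hat supplies x with A2hat x = - Z2^T w, which puts [Amu] x + w in the range
    of [Mmu]. *)
Lemma Mmu_jet_surjective : row_free (A2hat I A Z2 t) -> jet_surjective I E A mu.+1 t.
Proof.
move=> fA g pg.
have cg : CkMx I mu.+1 g by exact: (poly_fun_Ck ab).
pose w := \mxcol_(i < mu.+1) derivnMx I i g t.
pose x := - (pinvmx (A2hat I A Z2 t) *m ((Z2 t)^T *m w)).
have [|y My] := @range_Mmu (Amu I A mu t *m x + w).
  rewrite mulmxDr mulmxA -[_ *m Amu _ _ _ _]/(A2hat I A Z2 t) /x mulmxN mulmxA.
  by rewrite (mulmxVp fA) mul1mx addNr.
have [phi pphi [phix phiy]] := prescribed_jet x y It.
exists phi => //; have [_ F] := flat_derivative_array It pphi cg.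
by apply: F; rewrite phix phiy -My addrC addKr.
Qed.

End DerivativeArray.


(** * Sylvester's law of inertia *)

Section Sylvester.
Variable R : rcfType.

Lemma trmx11 (x : 'M[R]_1) : x^T = x.
Proof. by rewrite [x]mx11_scalar tr_scalar_mx. Qed.

(** [N] is a basis of ker (v^T G), the G-orthogonal complement of v; it meets the line of v
    trivially because v^T G v = 1. *)
Lemma split_unit_vector d (G : 'M[R]_(1 + d)) (v : 'cV_(1 + d)) : G^T = G ->
  v^T *m G *m v = 1%:M ->
  exists (N : 'M[R]_(1 + d, d)) (C : 'M[R]_(1 + d)), C \in unitmx /\
    C^T *m G *m C = block_mx 1%:M 0 0 (N^T *m G *m N).
Proof.
move=> sG vGv; pose D := v^T *m G.
have fD : row_free D by apply/row_freeP; exists v.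
have [L [N [H [h1 h2 h3 h4 h5]]]] := row_free_complement (erefl (1 + d)%N) fD.
exists N, (row_mx v N); split.
  apply: col_inj_unitmx => w; rewrite -[w]vsubmxK mul_row_col => e.
  have w1 : usubmx w = 0.
    have := congr1 (mulmx D) e; rewrite mulmxDr !mulmxA h3 mul0mx addr0 mulmx0.
    by rewrite /D vGv mul1mx.
  move: e; rewrite w1 mulmx0 add0r => /(congr1 (mulmx L)).
  by rewrite mulmxA h1 mul1mx mulmx0 => ->; rewrite col_mx0.
rewrite tr_row_mx mul_col_mx mul_col_row vGv -/D h3; congr block_mx.
by apply: trmx_inj; rewrite trmx0 !trmx_mul trmxK sG mulmxA.
Qed.

Lemma block_diag1_unit d (G : 'M[R]_d) : (block_mx (1%:M : 'M[R]_1) 0 0 G \in unitmx) = (G \in unitmx).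
Proof. by rewrite !unitmxE det_ublock det1 mul1r. Qed.

Lemma congruence_unit d (G C : 'M[R]_d) : C \in unitmx -> (C^T *m G *m C \in unitmx) = (G \in unitmx).
Proof. by move=> uC; rewrite !unitmx_mul unitmx_tr uC andbT. Qed.

Lemma normalize_vector d (G : 'M[R]_d) (v : 'cV_d) : 0 < (v^T *m G *m v) 0 0 ->
  exists w : 'cV_d, w^T *m G *m w = 1%:M.
Proof.
move=> v0; set x := _ 0 0 in v0; exists ((Num.sqrt x)^-1 *: v).
rewrite -scalemxAr [(_ *: v)^T]linearZ /= -!scalemxAl scalerA [_ *m v]mx11_scalar -/x.
rewrite -scalemx1 scalerA -invfM -expr2 sqr_sqrtr ?ltW//.
by rewrite mulVf ?scale1r// gt_eqF.
Qed.

(** Polarization: otherwise v^T G w = 0 for all v, w; but w = G^-1 v gives v^T v, which is positive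
    for the all-ones vector. *)
Lemma quadratic_form_neq0 d (G : 'M[R]_d.+1) : G^T = G -> G \in unitmx ->
  exists v : 'cV_d.+1, (v^T *m G *m v) 0 0 != 0.
Proof.
move=> sG uG; apply: contrapT => H.
have q0 (v : 'cV_d.+1) : v^T *m G *m v = 0.
  apply/matrixP => i j; rewrite !ord1 [RHS]mxE; apply/eqP; apply: contrapT => h.
  by apply: H; exists v; apply/negP.
pose v : 'cV[R]_d.+1 := const_mx 1; pose w := invmx G *m v.
have := q0 (v + w); rewrite mulmxDr [(v + w)^T]linearD /= !mulmxDl !q0 add0r addr0.
have sym (u u' : 'cV[R]_d.+1) : u^T *m G *m u' = u'^T *m G *m u.
  by rewrite -[LHS]trmx11 !trmx_mul trmxK sG mulmxA.
rewrite (sym w) /w [v^T *m G *m _]mulmxA mulmxK// => /matrixP/(_ 0 0)/eqP.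
rewrite !mxE -mulr2n mulrn_eq0 /= psumr_eq0; last by move=> i _; rewrite !mxE mulr1.
by move=> /allP/(_ 0 (mem_index_enum _)); rewrite !mxE mulr1 oner_eq0.
Qed.

(** Used twice: for the definite remainder in Sylvester's law, and for the initial value of the
    orthonormal frame. *)
Lemma pos_form_congruence d (G : 'M[R]_d) : G^T = G -> G \in unitmx ->
  (forall v : 'cV_d, 0 <= (v^T *m G *m v) 0 0) ->
  exists2 C : 'M[R]_d, C \in unitmx & C^T *m G *m C = 1%:M.
Proof.
elim: d G => [|d IH] G sG uG pG.
  by exists 1%:M; [exact: unitmx1|apply/matrixP => -[]].
have [v v0] := quadratic_form_neq0 sG uG.
have [|w wGw] := normalize_vector (G := G) (v := v); first by rewrite lt_def v0 pG.
move: G sG uG pG w wGw {v v0}; rewrite -[d.+1]/(1 + d)%N => G sG uG pG w wGw.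
have [N [C [uC CGC]]] := split_unit_vector sG wGw.
have [||v|C1 uC1 C1G] := IH (N^T *m G *m N).
- by rewrite !trmx_mul trmxK sG mulmxA.
- by rewrite -block_diag1_unit -CGC congruence_unit.
- by have := pG (N *m v); rewrite trmx_mul !mulmxA.
exists (C *m block_mx 1%:M 0 0 C1); first by rewrite unitmx_mul uC block_diag1_unit.
rewrite trmx_mul -!mulmxA [G *m _]mulmxA [C^T *m _]mulmxA [C^T *m _]mulmxA CGC.
rewrite tr_block_mx !trmx0 trmx1 !mulmx_block.
rewrite !mulmxA in C1G.
rewrite !(mul0mx, mulmx0, addr0, add0r, mul1mx, mulmx1) !mulmxA C1G.
by rewrite -scalar_mx_block.
Qed.

(** Indexed by the total size, so that the induction on [d] needs no cast. *)
Definition sign_mx p d : 'M[R]_d := \matrix_(i, j) ((if (i < p)%N then 1 else -1) *+ (i == j)).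

Lemma sign_mxS p d : sign_mx p.+1 (1 + d) = block_mx 1%:M 0 0 (sign_mx p d).
Proof.
apply/matrixP => i j; rewrite -(fintype.splitK i) -(fintype.splitK j).
case: (fintype.split i) => k; case: (fintype.split j) => l /=;
  rewrite ?(block_mxEul, block_mxEur, block_mxEdl, block_mxEdr) !mxE.
- by rewrite !ord1.
- by rewrite eq_lrshift.
- by rewrite eq_rlshift.
- by rewrite eq_rshift.
Qed.

(** Unit vectors are split off as long as the form takes a positive value; after that its negative
    is nonnegative and nonsingular, hence congruent to the identity. *)
Lemma sylvester d (G : 'M[R]_d) : G^T = G -> G \in unitmx ->
  exists p (C : 'M[R]_d), [/\ (p <= d)%N, C \in unitmx & C^T *m G *m C = sign_mx p d].
Proof.
elim: d G => [|d IH] G sG uG.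
  by exists 0%N, 1%:M; split=> //; [exact: unitmx1|apply/matrixP => -[]].
have [[v v0]|nv] := pselect (exists v : 'cV_d.+1, 0 < (v^T *m G *m v) 0 0); last first.
  have [||v|C uC CGC] := @pos_form_congruence _ (- G).
  - by rewrite linearN /= sG.
  - by rewrite -scaleN1r unitmxZ// unitrN1.
  - rewrite mulmxN mulNmx mxE oppr_ge0 leNgt; apply/negP => h.
    by apply: nv; exists v.
  exists 0%N, C; split=> //; apply: oppr_inj; rewrite -[LHS]mulNmx -mulmxN CGC.
  by apply/matrixP => i j; rewrite !mxE /= mulNrn opprK.
have [w wGw] := normalize_vector v0.
move: G sG uG w wGw {v v0}; rewrite -[d.+1]/(1 + d)%N => G sG uG w wGw.
have [N [C [uC CGC]]] := split_unit_vector sG wGw.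
have [||p [C1 [pd uC1 C1G]]] := IH (N^T *m G *m N).
- by rewrite !trmx_mul trmxK sG mulmxA.
- by rewrite -block_diag1_unit -CGC congruence_unit.
exists p.+1, (C *m block_mx 1%:M 0 0 C1); split; first by [].
  by rewrite unitmx_mul uC block_diag1_unit.
rewrite trmx_mul -!mulmxA [G *m _]mulmxA [C^T *m _]mulmxA [C^T *m _]mulmxA CGC.
rewrite tr_block_mx !trmx0 trmx1 !mulmx_block.
rewrite !mulmxA in C1G.
rewrite !(mul0mx, mulmx0, addr0, add0r, mul1mx, mulmx1) !mulmxA C1G.
by rewrite sign_mxS.
Qed.

End Sylvester.

Lemma sign_mx_signature (R : realType) p q : sign_mx R p (p + q) = signature_mx R p q.
Proof.
apply/matrixP => i j; rewrite -(fintype.splitK i) -(fintype.splitK j) /signature_mx.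
case: (fintype.split i) => k; case: (fintype.split j) => l /=;
  rewrite ?(block_mxEul, block_mxEur, block_mxEdl, block_mxEdr) !mxE /=.
- by rewrite ltn_ord eq_lshift.
- by rewrite eq_lrshift.
- by rewrite eq_rlshift.
- by rewrite eq_rshift ltnNge leq_addr /= mulNrn.
Qed.


(** * Skew-adjoint equations *)

Lemma eqmx_kermx_col (F : fieldType) m n p (K : 'M[F]_(n, p)) (B : 'M[F]_(m, n)) :
  (K^T == kermx B^T)%MS ->
  B *m K = 0 /\ forall x : 'cV_n, B *m x = 0 -> exists y : 'cV_p, x = K *m y.
Proof.
move=> /andP[/sub_kermxP BK kK]; split.
  by apply: trmx_inj; rewrite trmx_mul trmx0.
move=> x Bx; have : (x^T <= K^T)%MS.
  by apply: submx_trans kK; apply/sub_kermxP; rewrite -trmx_mul Bx trmx0.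
by move=> /submxP[y xy]; exists y^T; apply: trmx_inj; rewrite trmx_mul trmxK.
Qed.

Lemma col_full_inj (F : fieldType) m n p (K : 'M[F]_(m, n)) (x : 'M[F]_(n, p)) :
  \rank K = n -> K *m x = 0 -> x = 0.
Proof.
move=> rK Kx; have fK : row_free K^T by rewrite /row_free mxrank_tr rK.
apply: trmx_inj; apply/eqP; rewrite trmx0 -(mulmx_free_eq0 _ fK) -trmx_mul Kx.
by rewrite trmx0.
Qed.

Section ReducedDAE.
Variables (R : realType) (al be : R) (n mu a d r : nat) (E A : R -> 'M[R]_n).
Hypotheses (hI : al < be) (hr : (0 < r)%N).
Local Notation I := `[al, be]%classic.
Hypotheses (hE : CkMx I (mu + r)%N E) (hA : CkMx I (mu + r)%N A).
Variables (Z2 : R -> 'M[R]_(\sum_(i < mu.+1) n, a)) (K Z1 : R -> 'M[R]_(n, d)).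
Hypotheses
  (hM : forall t, I t -> (\rank (Mmu I E A mu t) + a)%N = (mu.+1 * n)%N)
  (hZ2 : admissible_Z2 I E A r Z2)
  (hA2 : forall t, I t -> \rank (A2hat I A Z2 t) = a)
  (hK : admissible_K I A r Z2 K)
  (hEK : forall t, I t -> \rank (E t *m K t) = d)
  (hZ1 : admissible_Z1 I E r K Z1).

Let Ial : I al. Proof. by rewrite /= in_itv /= lexx ltW. Qed.
Let cE : CkMx I mu.+1 E.
Proof. by apply: CkMx_le hE; rewrite -addn1 leq_add2l. Qed.
Let cA : CkMx I mu.+1 A.
Proof. by apply: CkMx_le hA; rewrite -addn1 leq_add2l. Qed.
Let cEr : CkMx I r E. Proof. by apply: CkMx_le hE; exact: leq_addl. Qed.
Let cAr : CkMx I r A. Proof. by apply: CkMx_le hA; exact: leq_addl. Qed.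
Let cK : CkMx I r K. Proof. exact: hK.1. Qed.
Let cZ1 : CkMx I r Z1. Proof. exact: hZ1.1. Qed.

Lemma kernel_A2hat t : I t -> A2hat I A Z2 t *m K t = 0 /\
  forall x : 'cV_n, A2hat I A Z2 t *m x = 0 -> exists y : 'cV_d, x = K t *m y.
Proof. by move=> It; apply: eqmx_kermx_col; exact: (hK.2 t It).2. Qed.

Lemma jet_solution_A2hat t x : I t ->
  jet_solution I E A mu.+1 x t <-> A2hat I A Z2 t *m x = 0.
Proof.
move=> It; have [rZ ZM] := hZ2.2 t It.
exact: (jet_solutionP hI cE cA It (hM It) rZ ZM).
Qed.

Lemma regular_subitv c e : c < e -> al <= c -> e <= be ->
  exists c' e', [/\ c' < e', c <= c', e' <= e,
    dae_solvable `[c', e']%classic E A mu.+1 & dae_separating `[c', e']%classic E A mu.+1].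
Proof.
move=> ce ac eb; have sub := sub_itv_cc ac eb.
apply: exists_regular_subitv => //; [exact: CkMx_sub cE|exact: CkMx_sub cA| |].
  move=> t Jt; have It := sub t Jt; have [rZ ZM] := hZ2.2 t It.
  apply: (jet_surjective_sub hI ce ac eb cE cA Jt).
  apply: (Mmu_jet_surjective hI cE cA It (hM It) rZ ZM).
  by rewrite /row_free hA2.
move=> t Jt x /(jet_solution_sub hI ce ac eb cE cA _ Jt).
have It := sub t Jt; move=> /(jet_solution_A2hat _ It) /(kernel_A2hat It).2[y ->].
by rewrite mulmxA => /(col_full_inj (hEK It)) ->; rewrite mulmx0.
Qed.

Let ZEK t := (Z1 t)^T *m E t *m K t.
Let uZEK t : I t -> ZEK t \in unitmx.
Proof. by move=> It; rewrite -row_free_unit /row_free (hZ1.2 t It).2. Qed.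

(** The only candidate for X in L K = E K X, found by multiplying with Z1^T. It loses one derivative
    because of K'; the linear ODE regains it. *)
Definition reduced_coef t : 'M[R]_d := invmx (ZEK t) *m ((Z1 t)^T *m dae_op I E A K t).

Lemma CkMx_reduced_coef : CkMx I r.-1 reduced_coef.
Proof.
have le : (r.-1 <= r)%N by exact: leq_pred.
have cK1 : CkMx I r.-1.+1 K by rewrite prednK.
have cO : CkMx I r.-1 (dae_op I E A K).
  by apply: (CkMx_dae_op hI) cK1; [exact: CkMx_le cEr|exact: CkMx_le cAr].
have cZ : CkMx I r.-1 (fun t => (Z1 t)^T) by apply: (CkMxT hI); exact: CkMx_le cZ1.
apply: (CkMxM hI); last exact: (CkMxM hI).
apply: (CkMx_inv hI uZEK); apply: (CkMxM hI); last exact: CkMx_le cK.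
by apply: (CkMxM hI) cZ _; exact: CkMx_le cEr.
Qed.

(* The difference of both sides is continuous and vanishes on a dense set. *)
Lemma dae_op_kernel t : I t -> dae_op I E A K t = E t *m K t *m reduced_coef t.
Proof.
move=> It; apply/eqP; rewrite -subr_eq0; apply/eqP.
pose D t := dae_op I E A K t - E t *m K t *m reduced_coef t.
have cD : CkMx I 0 D.
  have cX := CkMx_le (leq0n r.-1) CkMx_reduced_coef.
  have cK0 := CkMx_le (leq0n r) cK; have cE0 := CkMx_le (leq0n r) cEr.
  apply: (CkMxB hI); last by apply: (CkMxM hI) cX; exact: (CkMxM hI).
  apply: (CkMx_dae_op hI) => //; first exact: CkMx_le cAr.
  exact: CkMx_le cK.
rewrite -/(D t); apply/matrixP => i j; rewrite [RHS]mxE; apply: contrapT => /eqP Dij.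
have near0 : nbhs t [set s | I s -> D s i j != 0].
  have c0 : CkI I 0 (fun s => D s i j) by exact: cD.
  have {c0}/continuous_itvP/(_ t It) c0 := c0.
  have H : nbhs (D t i j) [set x : R | x != 0].
    by apply: open_nbhs_nbhs; split => //; exact: open_neq.
  exact: c0 H.
have [c [e [ce ac eb _ D0]]] := exists_sub_itv hI It near0.
have [c' [e' [ce' cc' ee' solv _]]] := regular_subitv ce ac eb.
have ac' := le_trans ac cc'; have eb' := le_trans ee' eb.
pose J := `[c', e']%classic : set R.
have sub := sub_itv_cc ac' eb'.
have Jc : J c' by rewrite /J /= in_itv /= lexx ltW.
have Ic := sub _ Jc.
have /negP[] : D c' i j != 0.
  by apply: D0; exact: (sub_itv_cc cc' ee' Jc).
(* Column j of K takes values in ker A2hat, so solvability yields z = K y there. Multiplying by Z1^T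
   identifies y as column j of [reduced_coef], so column j of D vanishes. *)
pose x t : 'cV[R]_n := K t *m delta_mx j 0.
have cx : CkMx I r x by apply: (CkMxM hI) cK _; exact: (CkMx_cst hI).
have cx1 : CkMx I 1 x by exact: CkMx_le cx.
have [||z sz ez] := solv x _ _ c' Jc.
- exact: CkMx_sub cx1.
- move=> s Js; apply/(jet_solution_sub hI ce' ac' eb' cE cA _ Js).
  by apply/(jet_solution_A2hat _ (sub s Js)); rewrite mulmxA (kernel_A2hat (sub s Js)).1 mul0mx.
have [y zy] : exists y : 'cV_d, z = K c' *m y.
  apply: (kernel_A2hat Ic).2; apply/(jet_solution_A2hat _ Ic).
  exact/(jet_solution_sub hI ce' ac' eb' cE cA _ Jc).
have dK : is_dMx I K c' (derivMx I K c').
  by apply: (CkMx_dMx (k := 0)) Ic; exact: CkMx_le cK.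
have e1 : dae_op I E A K c' *m delta_mx j 0 = E c' *m K c' *m y.
  rewrite -[RHS]mulmxA -zy -ez -(dae_op_sub ce' ac' eb' _ _ Jc cx1).
  rewrite (dae_opE hI E A Ic (is_dMxMr (C := delta_mx j (0 : 'I_1)) dK)) /dae_op mulmxBl /x !mulmxA.
  by [].
have e2 : reduced_coef c' *m delta_mx j 0 = y.
  have e3 : (Z1 c')^T *m (E c' *m K c' *m y) = ZEK c' *m y by rewrite /ZEK !mulmxA.
  by rewrite /reduced_coef -2!mulmxA e1 e3 mulKmx// uZEK.
have : D c' *m delta_mx j 0 = 0 :> 'cV_n.
  by rewrite /D mulmxBl -[_ *m reduced_coef _ *m _]mulmxA e2 e1 subrr.
by move=> /matrixP/(_ i 0); rewrite -colE !mxE => ->.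
Qed.

Lemma linear_ode_fundamental m (B : R -> 'M[R]_m) (C : 'M[R]_m) : CkMx I r.-1 B ->
  exists Phi : R -> 'M[R]_m, [/\ CkMx I r Phi, Phi al = C
    & forall t, I t -> is_dMx I Phi t (B t *m Phi t)].
Proof.
move=> cB; have [Phi Pa dP] := linear_ode_exists hI C (CkMx_le (leq0n _) cB).
exists Phi; split=> //.
have := linear_ode_CkMx hI dP cB; by rewrite prednK.
Qed.

Let dK t : I t -> is_dMx I K t (derivMx I K t).
Proof. by move=> It; apply: (CkMx_dMx (k := 0)) It; exact: CkMx_le cK. Qed.

(** Phi' = - X Phi cancels L K = E K X in L (K Phi). Invertibility follows from the dual system Psi'
    = X^T Psi, since Psi^T Phi is constant and starts at the identity. *)
Lemma solution_frame : exists Phi : R -> 'M[R]_d, CkMx I r Phi /\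
  forall t, I t -> Phi t \in unitmx /\ dae_op I E A (fun s => K s *m Phi s) t = 0.
Proof.
have cX := CkMx_reduced_coef.
have [Phi [cPhi Pa dP]] := linear_ode_fundamental 1%:M (CkMxN hI cX).
have [Psi [_ Qa dQ]] := linear_ode_fundamental 1%:M (CkMxT hI cX).
exists Phi; split=> // t It; split.
  have d0 s : I s -> is_dMx I (fun u => (Psi u)^T *m Phi u) s 0.
    move=> Is; apply: is_dMx_eq; first exact: is_dMxM (is_dMxT (dQ s Is)) (dP s Is).
    by rewrite trmx_mul trmxK mulNmx mulmxN mulmxA addrN.
  have := is_dMx0_cst d0 It Ial; rewrite Qa Pa trmx1 mul1mx.
  by case/mulmx1_unit.
rewrite (dae_opE hI E A It (is_dMxM (dK It) (dP t It))) mulmxDr !mulmxA mulmxN mulNmx.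
rewrite addrAC -mulmxBl; have := dae_op_kernel It; rewrite /dae_op => ->.
by rewrite mulmxA addrN.
Qed.

(** With X' = - (K^T K)^-1 K^T K' X, the derivative of V = K X is orthogonal to the columns of V, so
    V^T V is constant; normalization is needed only at the left endpoint. *)
Lemma orthonormal_frame : exists X : R -> 'M[R]_d, CkMx I r X /\
  forall t, I t -> X t \in unitmx /\ (K t *m X t)^T *m (K t *m X t) = 1%:M.
Proof.
pose H t := (K t)^T *m K t.
have uH t : I t -> H t \in unitmx.
  move=> It; rewrite /H -{2}[K t]trmxK; apply: row_free_gram_unit.
  by rewrite /row_free mxrank_tr (hK.2 t It).1.
have le : (r.-1 <= r)%N by exact: leq_pred.
have cdK : CkMx I r.-1 (derivMx I K) by apply: (CkMx_deriv hI); rewrite prednK.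
have cH : CkMx I r.-1 H.
  by apply: CkMx_le le _; apply: (CkMxM hI) cK; exact: (CkMxT hI).
have cB : CkMx I r.-1 (fun t => - (invmx (H t) *m ((K t)^T *m derivMx I K t))).
  apply: (CkMxN hI); apply: (CkMxM hI); first exact: (CkMx_inv hI uH cH).
  by apply: (CkMxM hI) cdK; apply: CkMx_le le _; exact: (CkMxT hI).
have [||v|X0 _ X0H] := @pos_form_congruence _ _ (H al).
- by rewrite /H trmx_mul trmxK.
- exact: uH.
- rewrite /H mulmxA -trmx_mul -mulmxA mxE sumr_ge0// => i _.
  by rewrite [_^T _ _]mxE -expr2 sqr_ge0.
have [X [cX Xa dX]] := linear_ode_fundamental X0 cB.
exists X; split=> // t It.
have VV : (K t *m X t)^T *m (K t *m X t) = 1%:M.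
  pose V s := K s *m X s.
  have dV s : I s -> exists2 V', is_dMx I V s V' & (V s)^T *m V' = 0.
    move=> Is; eexists; first exact: is_dMxM (dK Is) (dX s Is).
    rewrite /V trmx_mul -mulmxA mulmxDr !mulNmx !mulmxN !mulmxA -/(H s) mulmxV ?uH// mul1mx.
    by rewrite addrN mulmx0.
  have d0 s : I s -> is_dMx I (fun u => (V u)^T *m V u) s 0.
    move=> Is; have [V' dV' VV'] := dV s Is.
    apply: is_dMx_eq; first exact: is_dMxM (is_dMxT dV') dV'.
    by rewrite VV' addr0; apply: trmx_inj; rewrite trmx_mul trmxK VV' trmx0.
  rewrite -/(V t) (is_dMx0_cst d0 It Ial) /V Xa trmx_mul -[RHS]X0H /H !mulmxA.
  by [].
split=> //; apply: col_inj_unitmx => v Xv.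
by rewrite -[v]mul1mx -VV -!mulmxA Xv !mulmx0.
Qed.

Hypothesis hskew : skew_adjoint I E A.

(** With E T' = A T the derivative is T^T (A^T + E' + A) T, which skew-adjointness makes zero. *)
Lemma solution_form_cst (T : R -> 'M[R]_(n, d)) : CkMx I r T ->
  (forall t, I t -> dae_op I E A T t = 0) ->
  forall t, I t -> (T t)^T *m E t *m T t = (T al)^T *m E al *m T al.
Proof.
move=> cT hT t It; apply: (is_dMx0_cst (X := fun s => (T s)^T *m E s *m T s)) It Ial => s Is.
have dT : is_dMx I T s (derivMx I T s).
  by apply: (CkMx_dMx (k := 0)) Is; exact: CkMx_le cT.
have dE : is_dMx I E s (derivMx I E s).
  by apply: (CkMx_dMx (k := 0)) Is; exact: CkMx_le cEr.
apply: is_dMx_eq; first exact: is_dMxM (is_dMxM (is_dMxT dT) dE) dT.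
have [sE sA] := hskew Is.
have ET : E s *m derivMx I T s = A s *m T s.
  by apply/eqP; rewrite -subr_eq0; apply/eqP; exact: hT.
have TE : (derivMx I T s)^T *m E s = (T s)^T *m (A s)^T.
  by rewrite -[E s]sE -!trmx_mul ET.
rewrite -[_ *m _ *m derivMx I T s]mulmxA ET TE sA -mulmxDr -mulmxA -mulmxDr.
by rewrite subrK mulNmx addNr mulmx0.
Qed.

(** If G0 y = 0, the row (T y)^T solves the adjoint equation, and (T y)^T E annihilates T, hence
    every jet solution. Separation gives E T y = 0 at one point, where injectivity of E K yields y =
    0. *)
Lemma solution_form_unit (T : R -> 'M[R]_(n, d)) (Phi : R -> 'M[R]_d) : CkMx I r T ->
  (forall t, I t -> dae_op I E A T t = 0) ->
  (forall t, I t -> Phi t \in unitmx /\ T t = K t *m Phi t) ->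
  (T al)^T *m E al *m T al \in unitmx.
Proof.
move=> cT hT TK; apply: col_inj_unitmx => y Gy.
have [c [e [ce ac eb _ sep]]] := regular_subitv hI (lexx al) (lexx be).
have sub := sub_itv_cc ac eb; pose J := `[c, e]%classic : set R.
pose xi t := (T t *m y)^T.
have Jc : J c by rewrite /J /= in_itv /= lexx ltW.
have Ic := sub _ Jc.
have dxi t : J t -> is_dMx J (fun s => xi s *m E s) t (- (xi t *m A t)).
  move=> Jt; have It := sub t Jt; apply: (is_dMx_sub ac eb).
  have dT : is_dMx I T t (derivMx I T t).
    by apply: (CkMx_dMx (k := 0)) It; exact: CkMx_le cT.
  have dE : is_dMx I E t (derivMx I E t).
    by apply: (CkMx_dMx (k := 0)) It; exact: CkMx_le cEr.
  apply: is_dMx_eq; first exact: is_dMxM (is_dMxT (is_dMxMr (C := y) dT)) dE.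
  have [sE sA] := hskew It.
  have ET : E t *m derivMx I T t = A t *m T t.
    by apply/eqP; rewrite -subr_eq0; apply/eqP; exact: hT.
  rewrite -{1}[E t]sE -trmx_mul mulmxA ET -mulmxA trmx_mul sA -/(xi t) -mulmxDr.
  by rewrite subrK mulmxN.
have xiE0 t : J t -> forall z, jet_solution J E A mu.+1 z t -> xi t *m E t *m z = 0.
  move=> Jt z /(jet_solution_sub hI ce ac eb cE cA _ Jt) sz; have It := sub t Jt.
  have [w ->] := (kernel_A2hat It).2 _ ((jet_solution_A2hat z It).1 sz).
  have [uP TP] := TK t It.
  have -> : K t = T t *m invmx (Phi t) by rewrite TP mulmxK.
  have [sE _] := hskew It.
  have xT : xi t *m E t *m T t = 0.
    apply: trmx_inj; rewrite trmx0 -Gy -(solution_form_cst cT hT It).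
    by rewrite /xi !trmx_mul !trmxK sE !mulmxA.
  by rewrite !mulmxA xT !mul0mx.
have := sep xi dxi xiE0 c Jc; have [sE _] := hskew Ic.
move=> /(congr1 trmx); rewrite trmx_mul trmxK sE trmx0 mulmxA.
have [uP ->] := TK c Ic; rewrite !mulmxA -mulmxA => /(col_full_inj (hEK Ic)).
by move=> /(congr1 (mulmx (invmx (Phi c)))); rewrite mulmx0 mulKmx.
Qed.

End ReducedDAE.


(** * Assembling the transformation *)

Lemma sign_mx_cast (R : realType) p q d (e : (p + q)%N = d) :
  castmx (e, e) (signature_mx R p q) = sign_mx R p d.
Proof. by case: d / e; rewrite castmx_id sign_mx_signature. Qed.

Lemma left_kernel_unique (F : fieldType) m q (M : 'M[F]_m) (Z Z' : 'M[F]_(m, q)) :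
  (\rank M + q)%N = m -> \rank Z = q -> \rank Z' = q -> Z^T *m M = 0 -> Z'^T *m M = 0 ->
  exists2 Y, Y \in unitmx & Z'^T = Y *m Z^T.
Proof.
move=> rM rZ rZ' /sub_kermxP ZM /sub_kermxP ZM'.
have rk : \rank (kermx M) = q by rewrite mxrank_ker -[X in (X - _)%N]rM addKn.
have kZ : (kermx M <= Z^T)%MS by rewrite -(mxrank_leqif_sup ZM) mxrank_tr rZ rk.
have /submxP[Y ZY] := submx_trans ZM' kZ; exists Y => //.
rewrite -row_free_unit; apply: inj_row_free => v vY.
have fZ : row_free Z'^T by rewrite /row_free mxrank_tr rZ'.
by apply/eqP; rewrite -(mulmx_free_eq0 _ fZ) ZY mulmxA vY mul0mx.
Qed.

Lemma CkMx_A2hat (R : realType) (a b : R) n mu q r (A : R -> 'M[R]_n)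
    (Z2 : R -> 'M[R]_(\sum_(i < mu.+1) n, q)) : a < b ->
  CkMx `[a, b]%classic (mu + r)%N A -> CkMx `[a, b]%classic r Z2 ->
  CkMx `[a, b]%classic r (A2hat `[a, b]%classic A Z2).
Proof.
move=> ab cA cZ; apply: (CkMxM ab); first exact: (CkMxT ab).
move=> i j; apply: (@CkI_ext _ _ _ ab _ (fun t =>
    iter (tagnat.sig1 i) (derivI `[a, b]%classic) (fun s => A s (tagnat.sig2 i) j) t)).
  by move=> s _; rewrite mxE derivnMxE.
apply: CkI_iter; apply: CkI_le (cA _ j); rewrite leq_add2r -ltnS; exact: ltn_ord.
Qed.

Lemma CkMx_castmx_col (R : realType) (I : set R) k m n n' (e : n = n') (X : R -> 'M[R]_(m, n)) :
  CkMx I k X -> CkMx I k (fun t => castmx (erefl m, e) (X t)).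
Proof. by case: n' / e => cX; under eq_fun do rewrite castmx_id. Qed.

Lemma castmx_row_unit (F : fieldType) p q n (e : (p + q)%N = n)
    (X : 'M[F]_(n, p)) (Y : 'M[F]_(n, q)) :
  (forall v w, X *m v + Y *m w = 0 :> 'cV_n -> v = 0 /\ w = 0) ->
  castmx (erefl n, e) (row_mx X Y) \in unitmx.
Proof.
case: n / e X Y => X Y H; rewrite castmx_id; apply: col_inj_unitmx => v.
by rewrite -[v]vsubmxK mul_row_col => /H[-> ->]; rewrite col_mx0.
Qed.

Theorem theorem4p4 (R : realType) (al be : R) (hI : al < be)
    (n mu a d r : nat) (hr : (0 < r)%N) (had : (d + a)%N = n)
    (E A : R -> 'M[R]_n) (f : R -> 'cV[R]_n)
    (hE : CkMx `[al, be] (mu + r)%N E) (hA : CkMx `[al, be] (mu + r)%N A)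
    (hf : CkMx `[al, be] (mu + r)%N f)
    (hH : hypothesis_H `[al, be] E A mu a d r)
    (hskew : skew_adjoint `[al, be] E A) :
  exists (p q : nat) (hpq : (p + q)%N = d),
  let S := castmx (hpq, hpq) (signature_mx R p q) in
  exists (Q : R -> 'M[R]_n) (T2 : R -> 'M[R]_(n, d)) (T2' : R -> 'M[R]_(n, a)),
  forall (Z2 : R -> 'M[R]_(\sum_(i < mu.+1) n, a)) (K Z1 : R -> 'M[R]_(n, d)),
    admissible `[al, be] E A r Z2 K Z1 ->
    restricted_class `[al, be] E A had r S Z2 Q T2 T2' /\
    exists (Atil : R -> 'M[R]_d) (ftil : R -> 'cV[R]_d),
      inherent_ODE `[al, be] E A f Z2 Z1 T2 T2' Atil ftil /\
      generalized_orthogonal_flow `[al, be] S Atil.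
Proof.
set I := `[al, be]%classic : set R in hE hA hf hH hskew *.
have Ial : I al by rewrite /I /= in_itv /= lexx ltW.
have [hM [Z2 hZ2 [hA2 [K hK [hEK [Z1 hZ1]]]]]] := hH.
have [Phi [cPhi hPhi]] := solution_frame hI hr hE hA hM hZ2 hA2 hK hEK hZ1.
have [X [cX hX]] := orthonormal_frame hI hr hK.
have [T [cT hT TK]] : exists T, [/\ CkMx I r T, forall t, I t -> dae_op I E A T t = 0
    & forall t, I t -> Phi t \in unitmx /\ T t = K t *m Phi t].
  exists (fun t => K t *m Phi t); split; first exact: (CkMxM hI hK.1 cPhi).
    by move=> t It; exact: (hPhi t It).2.
  by move=> t It; split; first exact: (hPhi t It).1.
pose G0 := (T al)^T *m E al *m T al.
have uG0 : G0 \in unitmx := solution_form_unit hI hr hE hA hM hZ2 hA2 hK hEK hskew cT hT TK.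
have sG0 : G0^T = G0 by rewrite /G0 !trmx_mul trmxK (hskew al Ial).1 mulmxA.
have [p [C [pd uC CG]]] := sylvester sG0 uG0.
exists p, (d - p)%N, (subnKC pd); rewrite sign_mx_cast => S.
have [T2 cT2 T2E] : exists2 T2, CkMx I r T2 & forall t, T2 t = T t *m C.
  by exists (fun t => T t *m C) => //; apply: (CkMxM hI) cT _; exact: (CkMx_cst hI).
(* The transpose of A2hat spans the orthogonal complement of its kernel: A2hat T2' is a Gram matrix,
   and T2' completes T2 at every point. *)
have [T2' cT2' T2'E] : exists2 T2', CkMx I r T2' & forall t, T2' t = (A2hat I A Z2 t)^T.
  exists (fun t => (A2hat I A Z2 t)^T) => //.
  by apply: (CkMxT hI); apply: (CkMx_A2hat hI hA); exact: hZ2.1.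
have T2_inj t (It : I t) (v : 'cV_d) : T2 t *m v = 0 -> v = 0.
  rewrite T2E (TK t It).2 -!mulmxA => /(col_full_inj (hK.2 t It).1).
  move=> /(congr1 (mulmx (invmx (Phi t)))); rewrite mulmx0 mulKmx ?(hPhi t It).1//.
  by move=> /(congr1 (mulmx (invmx C))); rewrite mulmx0 mulKmx.
have AT2 t (It : I t) : A2hat I A Z2 t *m T2 t = 0.
  by rewrite T2E (TK t It).2 !mulmxA (kernel_A2hat hK It).1 !mul0mx.
have opT2 t (It : I t) : dae_op I E A T2 t = 0.
  have dT : is_dMx I T t (derivMx I T t).
    by apply: (CkMx_dMx (k := 0)) It; exact: CkMx_le cT.
  rewrite (dae_op_ext E A (y := fun t => T t *m C) (fun s _ => T2E s) It).
  rewrite (dae_opE hI E A It (is_dMxMr (C := C) dT)) !mulmxA -mulmxBl.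
  by have := hT t It; rewrite /dae_op => ->; rewrite mul0mx.
have uAT t (It : I t) : A2hat I A Z2 t *m T2' t \in unitmx.
  by rewrite T2'E; apply: row_free_gram_unit; rewrite /row_free hA2.
exists (fun t => castmx (erefl n, had) (row_mx (T2 t) (T2' t))), T2, T2'.
(* The transformation was built from one admissible triple; from here on it is tested against an
   arbitrary one. *)
move=> Z2a K1 Z1a [aZ2 aK aZ1].
have AY t (It : I t) : exists2 Y, Y \in unitmx & A2hat I A Z2a t = Y *m A2hat I A Z2 t.
  have [rZ ZM] := hZ2.2 t It; have [rZ' ZM'] := aZ2.2 t It.
  have [|Y uY ZY] := left_kernel_unique _ rZ rZ' ZM ZM'.
    by rewrite (hM t It) sum_nat_const card_ord.
  by exists Y => //; rewrite /A2hat ZY mulmxA.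
have uAT' t (It : I t) : A2hat I A Z2a t *m T2' t \in unitmx.
  by have [Y uY ->] := AY t It; rewrite -mulmxA unitmx_mul uY uAT.
have AT2a t (It : I t) : A2hat I A Z2a t *m T2 t = 0.
  by have [Y uY ->] := AY t It; rewrite -mulmxA AT2// mulmx0.
split.
  split=> //.
    split; first by apply: CkMx_castmx_col; exact: CkMx_row.
    move=> t It; apply: castmx_row_unit => v w e.
    have w0 : w = 0.
      have := congr1 (mulmx (A2hat I A Z2 t)) e.
      rewrite mulmxDr !mulmxA AT2// mul0mx add0r mulmx0.
      by move=> /(congr1 (mulmx (invmx (A2hat I A Z2 t *m T2' t)))); rewrite mulKmx ?uAT// mulmx0.
    by split=> //; apply: (T2_inj t It); move: e; rewrite w0 mulmx0 addr0.
  have [V cV VE] : exists2 V, CkMx I r V & forall t, V t = K t *m X t.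
    by exists (fun t => K t *m X t) => //; exact: (CkMxM hI hK.1 cX).
  (* V V^T is the orthogonal projection onto ker A2hat, which contains the columns of T2; so this W
     satisfies V W = T2. *)
  have [W cW WE] : exists2 W, CkMx I r W & forall t, W t = (V t)^T *m T2 t.
    exists (fun t => (V t)^T *m T2 t) => //.
    by apply: (CkMxM hI) cT2; exact: (CkMxT hI).
  have VV t (It : I t) : (V t)^T *m V t = 1%:M by rewrite VE (hX t It).2.
  have VW t (It : I t) : T2 t = V t *m W t.
    have E2 : T2 t = V t *m (invmx (X t) *m (Phi t *m C)).
      by rewrite VE mulmxA mulmxK ?(hX t It).1// T2E (TK t It).2 mulmxA.
    by rewrite WE {2}E2 [(V t)^T *m _]mulmxA VV// mul1mx -E2.
  exists V, W; split=> //.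
  - move=> t It; split; first exact: VV.
    have [Y uY AYE] := AY t It; have [AK _] := kernel_A2hat hK It.
    apply/andP; split.
      apply/sub_kermxP; rewrite -trmx_mul AYE -mulmxA VE [A2hat _ _ _ _ *m _]mulmxA AK.
      by rewrite mul0mx mulmx0 trmx0.
    rewrite VE [(K t *m X t)^T]trmx_mul; apply: (submx_trans (B := (K t)^T)); last first.
      have uXT : (X t)^T \in unitmx by rewrite unitmx_tr (hX t It).1.
      by apply/submxP; exists (invmx ((X t)^T)); rewrite mulKmx.
    have /andP[_] := (hK.2 t It).2; apply: submx_trans; apply/sub_kermxP.
    have : kermx (A2hat I A Z2a t)^T *m (A2hat I A Z2a t)^T = 0 by exact: mulmx_ker.
    rewrite {2}AYE [(Y *m _)^T]trmx_mul mulmxA => /(congr1 (mulmx^~ (invmx (Y^T)))).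
    by rewrite mulmxK ?unitmx_tr// mul0mx.
  - split=> // t It; apply: col_inj_unitmx => v Wv; apply: (T2_inj t It).
    by rewrite VW// -mulmxA Wv mulmx0.
  - move=> t It; rewrite -trmx_mul -[_ *m V t *m W t]mulmxA -VW// T2E trmx_mul.
    rewrite -!mulmxA [E t *m _]mulmxA [(T t)^T *m _]mulmxA [(T t)^T *m _]mulmxA.
    by rewrite (solution_form_cst hI hr hE hskew cT hT It) mulmxA CG.
(* Since A2hat T2 = 0, x2 does not depend on x1. The elimination leaves [odeL] = Z1^T E T2 and
   [odeA] = - Z1^T L T2 = 0. *)
have x2G0 t : I t -> x2G I A Z2a T2 T2' t = 0.
  by move=> It; rewrite /x2G AT2a// mulmx0 oppr0.
have dx2G0 t : I t -> derivMx I (x2G I A Z2a T2 T2') t = 0.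
  move=> It; apply: (is_dMx_derivMx hI It).
  by apply: (is_dMx_ext (X := fun=> 0)) It (is_dMx_cst _ _ _ _) => s Is; rewrite x2G0.
exists (fun t => invmx (odeL I E A Z2a Z1a T2 T2' t) *m odeA I E A Z2a Z1a T2 T2' t).
exists (fun t => invmx (odeL I E A Z2a Z1a T2 T2' t) *m odef I E A f Z2a Z1a T2' t).
split.
  move=> t It; split=> //; first exact: uAT'.
  (* T2 v lies in ker A2hat, hence equals K1 u, and Z1^T E K1 is nonsingular for every admissible
     triple. *)
  rewrite /odeL x2G0// mulmx0 addr0; apply: col_inj_unitmx => v ZETv.
  have [_ kK1] := eqmx_kermx_col (aK.2 t It).2.
  have [u Tv] : exists u : 'cV_d, T2 t *m v = K1 t *m u.
    by apply: kK1; rewrite mulmxA AT2a// mul0mx.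
  have : u = 0.
    apply: (col_full_inj (aZ1.2 t It).2); rewrite -[_ *m u]mulmxA -Tv mulmxA.
    exact: ZETv.
  by move=> u0; apply: (T2_inj t It); rewrite Tv u0 mulmx0.
have A0 t : I t -> odeA I E A Z2a Z1a T2 T2' t = 0.
  move=> It; rewrite /odeA x2G0// dx2G0// !mulmx0 subr0 addr0 /A1hat /E1hat -!mulmxA -mulmxBr.
  rewrite -opprB -[E t *m _ - _]/(dae_op I E A T2 t) opT2// oppr0 mulmx0//.
move=> t0 It0; split.
  exists (fun=> 1%:M); split=> // t It.
  have d1 := is_dMx_cst al be (1%:M : 'M[R]_d) t.
  split; first by move=> i j; exact: is_dI_cvg (d1 i j).
  by rewrite (is_dMx_derivMx hI It d1) A0// mulmx0 mul0mx.
move=> Psi [dPsi Psi0] t It.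
have -> : Psi t = 1%:M.
  rewrite -Psi0; apply: (is_dMx0_cst _ It It0) => s Is i j.
  have [dP eP] := dPsi s Is.
  have /matrixP/(_ i j) : derivMx I Psi s = 0 by rewrite eP A0// mulmx0 mul0mx.
  by rewrite !mxE => <-; exact: derivIP Is (dP i j).
by rewrite trmx1 mul1mx mulmx1.
Qed.
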